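(* Let $X$ be a Fréchet space with an infinite-dimensional normable quotient, and let $\mathcal{F}$ be a free filter on $\mathbb{N}$. - The uniform $\mathcal{F}$-boundedness principle holds for $X$ if and only if $\mathcal{F}$ is a UBP-filter. - The stationary uniform $\mathcal{F}$-boundedness principle holds for $X$ if and only if $\mathcal{F}$ is a stationary UBP-filter.
   Context: $\mathbb{N}=\{0,1,2,\ldots\}$. A filter on $\mathbb{N}$ is a non-empty, upwards closed family $\mathcal{F}\subsetneq P(\mathbb{N})$ closed under finite intersections; it is free if it contains all cofinite subsets of $\mathbb{N}$. A set $A\subseteq\mathbb{N}$ is $\mathcal{F}$-stationary if $\mathbb{N}\setminus A\notin\mathcal{F}$. $(\forall_{\mathcal{F}}\, i\in\mathbb{N})\,\Phi(i)$ means $\{i\in\mathbb{N}:\Phi(i)\}\in\mathcal{F}$. For topological vector spaces $X,Y$, $\mathcal{L}(X,Y)$ is the space of continuous linear maps. A sequence $(y_i)_i$ in $Y$ is $\mathcal{F}$-bounded if for every $0$-neighbourhood $V$ in $Y$ there is $t>0$ with $ty_i\in V$ $(\forall_{\mathcal{F}}\, i\in\mathbb{N})$. A sequence $(T_i)_i$ in $\mathcal{L}(X,Y)$ is pointwise $\mathcal{F}$-bounded if $(T_i(x))_i$ is $\mathcal{F}$-bounded for every $x\in X$. It is $\mathcal{F}$-equicontinuous if for every $0$-neighbourhood $V$ in $Y$ there is a $0$-neighbourhood $U$ in $X$ with $T_i[U]\subseteq V$ $(\forall_{\mathcal{F}}\, i\in\mathbb{N})$. It is $\mathcal{F}$-stationary-equicontinuous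 if for every $\mathcal{F}$-stationary set $I$ and every $0$-neighbourhood $V$ in $Y$ there are a $0$-neighbourhood $U$ in $X$ and an $\mathcal{F}$-stationary set $J\subseteq I$ with $T_i[U]\subseteq V$ for all $i\in J$. The uniform (resp. stationary uniform) $\mathcal{F}$-boundedness principle holds for $X$ if for every locally convex space $Y$, every pointwise $\mathcal{F}$-bounded sequence in $\mathcal{L}(X,Y)$ is $\mathcal{F}$-equicontinuous (resp. $\mathcal{F}$-stationary-equicontinuous). $\mathcal{F}$ is a UBP-filter (resp. stationary UBP-filter) if the uniform (resp. stationary uniform) $\mathcal{F}$-boundedness principle holds for every Fréchet space (in the paper these are the same classes as those obtained with ''Banach space'' in place of ''Fréchet space''). *)

(* Defs.v *)
From HB Require Import structures.
From mathcomp Require Import all_boot all_order all_algebra.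
From mathcomp Require Export all_classical all_reals topology normedtype.
From mathcomp Require Export complex.

Set Implicit Arguments.
Unset Strict Implicit.
Unset Printing Implicit Defensive.

Import Order.TTheory GRing.Theory Num.Theory.
Import numFieldNormedType.Exports.

Local Open Scope classical_set_scope.
Local Open Scope ring_scope.

(* [frechet_filter] is the library's filter of cofinite sets. *)
Definition free_filter (F : set_system nat) : Prop := @frechet_filter nat `<=` F.

Definition filter_stationary (F : set_system nat) (A : set nat) : Prop := ~ F (~` A).

(* Distances and norms take values in the scalar field [K], as norms do in
   MathComp; for [K = R[i]], [0 <= z] forces [z] to be a nonnegative real. *)
Section Metrizability.
Variable K : numFieldType.

Definition is_distance (T : Type) (d : T -> T -> K) : Prop :=
  [/\ forall x y, 0 <= d x y,
      forall x y, d x y = 0 <-> x = y,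
      forall x y, d x y = d y x &
      forall x y z, d x z <= d x y + d y z].

Definition induces_topology (T : topologicalType) (d : T -> T -> K) : Prop :=
  forall (x : T) (A : set T),
    nbhs x A <-> exists2 r : K, 0 < r & [set y | d x y < r] `<=` A.

Definition metrizable (T : topologicalType) : Prop :=
  exists2 d : T -> T -> K, is_distance d & induces_topology d.

Definition is_norm (E : lmodType K) (p : E -> K) : Prop :=
  [/\ forall x, 0 <= p x,
      forall x, p x = 0 -> x = 0,
      forall (a : K) x, p (a *: x) = `|a| * p x &
      forall x y, p (x + y) <= p x + p y].

Definition normable (E : preTopologicalLmodType K) : Prop :=
  exists2 p : E -> K, is_norm p & induces_topology (fun x y => p (x - y)).

Definition infinite_dimensional (E : lmodType K) : Prop :=
  ~ exists (n : nat) (e : 'I_n -> E),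
      forall x, exists c : 'I_n -> K, x = \sum_(i < n) c i *: e i.

(* The entourages of a [tvsType] are only required to induce its topology, they
   need not be translation invariant.  Hence the library's [cauchy] is not the
   notion wanted here: being Cauchy refers to the uniformity determined by the
   additive group and the neighbourhoods of 0. *)
Definition additive_cauchy (X : tvsType K) (G : set_system X) : Prop :=
  forall U : set X, nbhs 0 U ->
    exists2 A, G A & forall x y, A x -> A y -> U (x - y).

Definition additively_complete (X : tvsType K) : Prop :=
  forall G : set_system X, ProperFilter G -> additive_cauchy G ->
    exists x : X, G --> x.

(* Local convexity is part of [tvsType]. *)
Definition frechet_space (X : tvsType K) : Prop :=
  metrizable X /\ additively_complete X.

End Metrizability.

Section SubmodZmod.
Variables (K : pzRingType) (V : lmodType K) (N : submodClosed V).

(* A copy of [N] on which closure under opposites, hence the library's quotient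
   of additive groups, is available. *)
Definition submod : {pred V} := N.

Fact submod_zmod_closed : zmod_closed submod.
Proof.
split=> [|x y xN yN]; first exact: (rpred0 N).
by rewrite -scaleN1r; apply: (rpredD (S := N)) => //; apply: (rpredZ (s := N)).
Qed.

HB.instance Definition _ := GRing.isZmodClosed.Build V submod submod_zmod_closed.

End SubmodZmod.

Definition quotient_space (K : numFieldType) (X : preTopologicalLmodType K)
    (N : submodClosed X) : Type :=
  quotient_topology (Quotient.quot (submod N)).

Section QuotientSpace.
Variables (K : numFieldType) (X : preTopologicalLmodType K).
Variable N : submodClosed X.
Local Open Scope quotient_scope.
Local Notation Q := (quotient_space N).

HB.instance Definition _ := Topological.on Q.
HB.instance Definition _ := Quotient.on Q.
HB.instance Definition _ := GRing.isZmodule.Build Q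
  (@Quotient.addqA _ (submod N)) (@Quotient.addqC _ (submod N))
  (@Quotient.add0q _ (submod N)) (@Quotient.addNq _ (submod N)).

Definition quotient_scale (a : K) (u : Q) : Q := \pi_Q (a *: repr u).

Fact pi_quotientP (x y : X) : reflect (\pi_Q x = \pi_Q y) (x - y \in N).
Proof.
have H : reflect (x = y %[mod Quotient.quot (submod N)]) (x - y \in submod N).
  by rewrite Quotient.idealrBE; exact: eqP.
exact: H.
Qed.

Fact piD (x y : X) : \pi_Q (x + y) = \pi_Q x + \pi_Q y.
Proof. exact: (@Quotient.pi_add _ (submod N)). Qed.

Fact pi_scale (a : K) (x : X) : \pi_Q (a *: x) = quotient_scale a (\pi_Q x).
Proof.
apply/esym/pi_quotientP; rewrite -scalerBr; apply: (rpredZ (s := N)).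
by apply/pi_quotientP; rewrite reprK.
Qed.

Fact quotient_scaleA a b u :
  quotient_scale a (quotient_scale b u) = quotient_scale (a * b) u.
Proof. by rewrite -[u]reprK -!pi_scale scalerA reprK. Qed.

Fact quotient_scale1 : left_id 1 quotient_scale.
Proof. by move=> u; rewrite -[u]reprK -pi_scale scale1r. Qed.

Fact quotient_scaleDr : right_distributive quotient_scale +%R.
Proof.
move=> a u v; rewrite -[u]reprK -[v]reprK -piD -!pi_scale.
by rewrite scalerDr piD.
Qed.

Fact quotient_scaleDl u : {morph quotient_scale^~ u : a b / a + b}.
Proof. by move=> a b; rewrite -[u]reprK -!pi_scale scalerDl piD. Qed.

HB.instance Definition _ := GRing.Zmodule_isLmodule.Build K Q
  quotient_scaleA quotient_scale1 quotient_scaleDr quotient_scaleDl.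

End QuotientSpace.

(* A subspace with normable, hence Hausdorff, quotient is closed; so closedness
   need not be required of [N]. *)
Definition has_infinite_dimensional_normable_quotient (K : numFieldType)
    (X : tvsType K) : Prop :=
  exists N : submodClosed X,
    infinite_dimensional (quotient_space N) /\ normable (quotient_space N).

Section FilterBoundedness.
Variables (K : numFieldType) (F : set_system nat).

Definition filter_bounded (Y : tvsType K) (y : nat -> Y) : Prop :=
  forall V : set Y, nbhs 0 V ->
    exists2 t : K, 0 < t & \forall i \near F, V (t *: y i).

Variables X Y : tvsType K.
Implicit Type T : nat -> {linear X -> Y}.

Definition pointwise_filter_bounded T : Prop :=
  forall x : X, filter_bounded (fun i => T i x).

Definition filter_equicontinuous T : Prop :=
  forall V : set Y, nbhs 0 V ->
    exists2 U : set X, nbhs 0 U & \forall i \near F, T i @` U `<=` V.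

Definition filter_stationary_equicontinuous T : Prop :=
  forall (I : set nat) (V : set Y), filter_stationary F I -> nbhs 0 V ->
    exists (U : set X) (J : set nat),
      [/\ nbhs 0 U, filter_stationary F J, J `<=` I &
          forall i, J i -> T i @` U `<=` V].

End FilterBoundedness.

Section UniformBoundedness.
Variables (K : numFieldType) (F : set_system nat).

(* Locally convex spaces [Y] are not required to be Hausdorff. *)
Definition uniform_boundedness_principle (X : tvsType K) : Prop :=
  forall (Y : tvsType K) (T : nat -> {linear X -> Y}),
    (forall i, continuous (T i)) ->
    pointwise_filter_bounded F T -> filter_equicontinuous F T.

Definition stationary_uniform_boundedness_principle (X : tvsType K) : Prop :=
  forall (Y : tvsType K) (T : nat -> {linear X -> Y}),
    (forall i, continuous (T i)) ->
    pointwise_filter_bounded F T -> filter_stationary_equicontinuous F T.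

Definition UBP_filter : Prop :=
  forall X : tvsType K, frechet_space X -> uniform_boundedness_principle X.

Definition stationary_UBP_filter : Prop :=
  forall X : tvsType K, frechet_space X ->
    stationary_uniform_boundedness_principle X.

End UniformBoundedness.

(* Main.v *)
Require Import Defs.
From HB Require Import structures.
From mathcomp Require Import all_boot all_order all_algebra.
From mathcomp Require Import all_classical all_reals topology normedtype.
From mathcomp Require Import complex.
From mathcomp Require Import perm convex interval_inference ring lra zify.

(* A failure of the uniform boundedness principle on some Frechet space is
   condensed into a function kappa on N, unbounded modulo F, such that every set
   meeting each class {kappa = k} in at most s(k) points is F-null, with s
   prescribed in advance: finitely many large functionals are simultaneously
   large at one vector, so a gliding hump x = sum_k x_k can be made to violate any
   bound on such a set of indices, and x would contradict pointwise boundedness.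

   Conversely such a kappa gives pointwise F-bounded, not F-equicontinuous
   functionals on every X with an infinite-dimensional normed quotient E.  If
   every set which is finite on each class is F-null, functionals of norm k that
   are eventually at most 1 at each vector of the unit ball of E are put on
   {kappa = k}: these exist by an approximate Josefson-Nissenzweig theorem.
   Otherwise some non-null set J is finite on each class, and functionals of norm
   k, of which at most s(k) exceed 1 at any vector of the unit ball, are put on
   J and {kappa = k}: these exist by the Dvoretzky-Rogers lemma.

   Approximate Josefson-Nissenzweig, for separated h_n in the dual ball: if all
   cluster functionals of (h_n) are close to the span of the h_n, a subsequence
   of (h_n) converges pointwise up to a small error.  Otherwise there are vectors
   X_m and functionals g_k with g_k(X_m) bounded below for m <= k and zero for m
   large.  This forces differences g_a - g_b to be large, and if these are not
   almost pointwise null they are large infinitely often at a single vector;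
   iterating on means (g_a + g_b) / 2 yields functionals r_j bounded below with
   sum_j r_j(x)^2 <= |x|^2. *)

Set Implicit Arguments.
Unset Strict Implicit.
Unset Printing Implicit Defensive.

Import Order.TTheory GRing.Theory Num.Theory.
Import numFieldNormedType.Exports.

Local Open Scope classical_set_scope.
Local Open Scope ring_scope.

(** * Hahn-Banach via minimal sublinear functionals *)

Section HahnBanach.
Variables (R : realType) (V : lmodType R).

(** Homogeneity is only an inequality, which infima inherit directly; applying it to the inverse
    factor gives equality. *)
Definition sublinear (q : V -> R) : Prop :=
  (forall x y, q (x + y) <= q x + q y) /\
  (forall t x, 0 < t -> q (t *: x) <= t * q x).

Lemma sublinear0 q : sublinear q -> q 0 = 0.
Proof.
move=> [qD qZ]; apply/eqP; rewrite eq_le; apply/andP; split.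
  have h : 0 < 2^-1 :> R by lra.
  by have := qZ _ 0 h; rewrite scaler0; lra.
by have := qD 0 0; rewrite addr0; lra.
Qed.

Lemma sublinearZ q t x : sublinear q -> 0 <= t -> q (t *: x) = t * q x.
Proof.
move=> qs; rewrite le_eqVlt => /predU1P[<-|t0].
  by rewrite scale0r mul0r sublinear0.
apply/eqP; rewrite eq_le qs.2//=.
have ti : 0 < t^-1 by rewrite invr_gt0.
have := qs.2 _ (t *: x) ti; rewrite scalerA mulVf ?gt_eqF// scale1r.
by rewrite ler_pdivlMl.
Qed.

Lemma sublinear_ge q x : sublinear q -> - q (- x) <= q x.
Proof.
by move=> qs; have := qs.1 x (- x); rewrite subrr (sublinear0 qs); lra.
Qed.

(* A cone [S] of pairs [(w, c)] encodes the constraints [c <= phi w]; the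
   infimum below is the largest sublinear functional forced by them. *)
Section InfAlong.
Variables (q : V -> R) (S : set (V * R)).
Hypotheses (qs : sublinear q) (S0 : S (0, 0)).
Hypothesis SD : forall u v, S u -> S v -> S (u.1 + v.1, u.2 + v.2).
Hypothesis SZ : forall t u, 0 < t -> S u -> S (t *: u.1, t * u.2).
Hypothesis Sq : forall u, S u -> u.2 <= q u.1.

Definition inf_along (x : V) : R := inf [set q (x + u.1) - u.2 | u in S].

Let has_inf_along x : has_inf [set q (x + u.1) - u.2 | u in S].
Proof.
split; first by exists (q (x + 0) - 0), (0, 0).
exists (- q (- x)) => _ [u Su <-].
have := qs.1 (x + u.1) (- x); rewrite addrAC subrr add0r => h.
by have := Sq Su; lra.
Qed.

Lemma inf_along_le x u : S u -> inf_along x <= q (x + u.1) - u.2.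
Proof. by move=> Su; apply: ge_inf; [case: (has_inf_along x)|exists u]. Qed.

Lemma inf_along_ge x b :
  (forall u, S u -> b <= q (x + u.1) - u.2) -> b <= inf_along x.
Proof.
by move=> h; apply: lb_le_inf; [case: (has_inf_along x)|move=> _ [u Su <-]; exact: h].
Qed.

Lemma inf_along_le_id x : inf_along x <= q x.
Proof. by have := inf_along_le x S0; rewrite /= addr0 subr0. Qed.

Lemma sublinear_inf_along : sublinear inf_along.
Proof.
split=> [x y|t x t0].
- suff h : inf_along (x + y) - inf_along y <= inf_along x by lra.
  apply: inf_along_ge => u Su.
  suff h : inf_along (x + y) - (q (x + u.1) - u.2) <= inf_along y by lra.
  apply: inf_along_ge => v Sv.
  have := inf_along_le (x + y) (SD Su Sv); rewrite /= addrACA.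
  by have := qs.1 (x + u.1) (y + v.1); lra.
- rewrite -ler_pdivrMl//; apply: inf_along_ge => u Su; rewrite ler_pdivrMl//.
  apply: le_trans (inf_along_le _ (SZ t0 Su)) _ => /=.
  by rewrite mulrBr lerB// -scalerDr; exact: qs.2.
Qed.

End InfAlong.

(** For fixed [y], the infimum along the ray of pairs [(t y, t q y)] is sublinear and below [q],
    hence equal to [q]; then [t = 1] gives [q x + q y <= q (x + y)]. *)
Lemma minimal_sublinear_scalar q : sublinear q ->
  (forall r, sublinear r -> (forall x, r x <= q x) -> r = q) -> scalar q.
Proof.
move=> qs qmin.
have qD x y : q (x + y) = q x + q y.
  pose S : set (V * R) := [set u | exists2 t, 0 <= t & u = (t *: y, t * q y)].
  have S0 : S (0, 0) by exists 0; rewrite ?scale0r ?mul0r.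
  have SD u v : S u -> S v -> S (u.1 + v.1, u.2 + v.2).
    move=> [t t0 ->] [s s0 ->]; exists (t + s); first exact: addr_ge0.
    by rewrite /= scalerDl mulrDl.
  have SZ t u : 0 < t -> S u -> S (t *: u.1, t * u.2).
    move=> t0 [s s0 ->]; exists (t * s); first by rewrite mulr_ge0// ltW.
    by rewrite /= scalerA mulrA.
  have Sq u : S u -> u.2 <= q u.1 by move=> [t t0 ->] /=; rewrite sublinearZ.
  have E : inf_along q S = q.
    by apply: qmin; [exact: sublinear_inf_along|move=> z; exact: inf_along_le_id].
  have Sy : S (y, q y) by exists 1; rewrite ?scale1r ?mul1r.
  have := inf_along_le qs S0 Sq x Sy; rewrite E /=; have := qs.1 x y; lra.
have qN x : q (- x) = - q x.
  by have := qD x (- x); rewrite subrr (sublinear0 qs); lra.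
move=> a x y; rewrite qD; congr (_ + _).
case: (leP 0 a) => [a0|/ltW a0]; first exact: sublinearZ.
rewrite -[a]opprK scaleNr qN sublinearZ ?oppr_ge0//; ring.
Qed.

Lemma scalar_below_sublinear q0 : sublinear q0 ->
  exists2 phi : V -> R, scalar phi & forall x, phi x <= q0 x.
Proof.
move=> q0s.
pose T := {q : V -> R | sublinear q /\ forall x, q x <= q0 x}.
(* The order is reversed: a maximal element for Zorn's lemma is a minimal functional. *)
pose below (q r : T) := `[< forall x, sval r x <= sval q x >].
have [| | | |[q [qs qq0]] qmin] := @Zorn T below.
- by move=> q; apply/asboolP.
- by move=> q r s /asboolP qr /asboolP rs; apply/asboolP => x; exact: le_trans (rs x) (qr x).
- move=> [q qP] [r rP] /asboolP/= qr /asboolP/= rq; apply/eq_exist/funext => x.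
  by apply/eqP; rewrite eq_le qr rq.
- move=> A Atot; have [[a Aa]|A0] := pselect (exists a, A a); last first.
    exists (exist _ q0 (conj q0s (fun=> lexx _))) => s As.
    by exfalso; apply: A0; exists s.
  pose r x := inf [set sval s x | s in A].
  (* The lower bound [- q0 (- x)], common to the whole chain, keeps the pointwise infimum finite. *)
  have rinf x : has_inf [set sval s x | s in A].
    split; first by exists (sval a x), a.
    exists (- q0 (- x)) => _ [s As <-]; case: s As => s [ss sq0] As /=.
    by have := sublinear_ge x ss; have := sq0 (- x); lra.
  have rle x s : A s -> r x <= sval s x.
    by move=> As; apply: ge_inf; [case: (rinf x)|exists s].
  have rge x b : (forall s, A s -> b <= sval s x) -> b <= r x.
    by move=> h; apply: lb_le_inf; [case: (rinf x)|move=> _ [s As <-]; exact: h].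
  have rs : sublinear r.
    split=> [x y|t x t0].
    + suff h : r (x + y) - r y <= r x by lra.
      apply/rge => s As.
      suff h : r (x + y) - sval s x <= r y by lra.
      apply/rge => s' As'.
      have [u [Au us us']] : exists u, [/\ A u, sval u x <= sval s x & sval u y <= sval s' y].
        have [/asboolP h|/asboolP h] := Atot _ _ As As'; first by exists s'.
        by exists s.
      have := rle (x + y) u Au; have := (svalP u).1.1 x y; lra.
    + rewrite -ler_pdivrMl//; apply/rge => s As; rewrite ler_pdivrMl//.
      by apply: le_trans (rle _ _ As) _; exact: (svalP s).1.2.
  have rq0 x : r x <= q0 x by apply: le_trans (rle _ _ Aa) _; exact: (svalP a).2.
  by exists (exist _ r (conj rs rq0)) => s As; apply/asboolP => x /=; exact: rle.
- exists q => //; apply: minimal_sublinear_scalar => // r rs rq.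
  have rq0 x : r x <= q0 x by exact: le_trans (rq x) (qq0 x).
  have /(congr1 (@sval _ _)) := qmin (exist _ r (conj rs rq0)) (asboolT rq).
  exact.
Qed.

(** A linear functional below [inf_along q S] satisfies the constraints, because at [- u.1] the
    infimum is at most [q 0 - u.2 = - u.2]. *)
Lemma hahn_banach_cone q (S : set (V * R)) : sublinear q -> S (0, 0) ->
  (forall u v, S u -> S v -> S (u.1 + v.1, u.2 + v.2)) ->
  (forall t u, 0 < t -> S u -> S (t *: u.1, t * u.2)) ->
  (forall u, S u -> u.2 <= q u.1) ->
  exists phi : V -> R, [/\ scalar phi, forall x, phi x <= q x &
    forall u, S u -> u.2 <= phi u.1].
Proof.
move=> qs S0 SD SZ Sq.
have [phi phil phiq] := scalar_below_sublinear (sublinear_inf_along qs S0 SD SZ Sq).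
exists phi; split => // [x|u Su].
  by apply: le_trans (phiq x) _; exact: inf_along_le_id.
have := phiq (- u.1); have := inf_along_le qs S0 Sq (- u.1) Su.
rewrite addNr (sublinear0 qs).
have -> : phi (- u.1) = - phi u.1.
  have := phil (-1) u.1 0; have := phil (-1) 0 0.
  by rewrite !scaler0 !addr0 scaleN1r; lra.
by lra.
Qed.

End HahnBanach.

(** * Dual balls and cluster functionals *)

(** Dependent choice in which each term may depend on all the earlier ones. *)
Lemma extend_seq (T : Type) (P : seq T -> Prop) : P [::] ->
  (forall l, P l -> exists t, P (rcons l t)) ->
  exists s : nat -> T, forall N, P (mkseq s N).
Proof.
move=> P0 Pext.
have [f fP] := choice (fun l : {l | P l} => Pext _ (svalP l)).
pose L := fix L n : {l | P l} :=
  if n is n'.+1 then exist _ _ (fP (L n')) else exist _ _ P0.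
exists (fun n => f (L n)) => N.
suff -> : mkseq (fun n => f (L n)) N = sval (L N) by exact: svalP.
elim: N => [//|N IH]; rewrite /mkseq -addn1 iotaD map_cat /= add0n cats1.
by rewrite -[map _ _]/(mkseq _ N) IH addn1.
Qed.

(** The limit is the supremum of the numbers lying below [u n] for [U]-almost all [n]. *)
Lemma ultrafilter_limit (R : realType) (U : set_system nat) (u : nat -> R) (B : R) :
  UltraFilter U -> (forall n, `|u n| <= B) ->
  exists l, forall e, 0 < e -> U [set n | `|u n - l| < e].
Proof.
move=> UU uB; pose E := [set r | U [set n | r <= u n]].
have supE : has_sup E.
  split.
    exists (- B); rewrite /E /=; apply: filterS filterT => n _ /=.
    by have := uB n; rewrite ler_norml => /andP[].
  exists B => r /filter_ex[n /= rn]; apply: le_trans rn _.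
  by have := uB n; rewrite ler_norml => /andP[].
exists (sup E) => e e0.
have e20 : 0 < e / 2 by rewrite divr_gt0.
have [r Er rE] := sup_adherent e20 supE.
have : ~ U [set n | sup E + e / 2 <= u n].
  move=> h; have : sup E + e / 2 <= sup E by apply: ub_le_sup; [case: supE|].
  lra.
have [//|h _] := in_ultra_setVsetC [set n | sup E + e / 2 <= u n] UU.
apply: filterS (filterI h Er) => n [/= /negP]; rewrite -ltNge => un rn.
by rewrite ltr_norml; apply/andP; split; lra.
Qed.

(** Weak-star compactness without a topology on the dual: [f] is the pointwise limit along an
    ultrafilter containing the tails of [S]. The first [M] terms of [ts] stand for an arbitrary
    finite set of points. *)
Lemma pointwise_cluster (R : realType) (T : Type) (u : nat -> T -> R) (B : T -> R)
    (S : set nat) :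
  (forall n t, `|u n t| <= B t) -> (forall N, exists2 n, (N <= n)%N & S n) ->
  exists f : T -> R, forall (ts : nat -> T) M N e, 0 < e ->
    exists n, [/\ (N <= n)%N, S n &
      forall j, (j < M)%N -> `|u n (ts j) - f (ts j)| < e].
Proof.
move=> uB Sinf.
pose G := [set A : set nat | exists N, forall n, (N <= n)%N -> S n -> A n].
have GP : ProperFilter G.
  apply: Build_ProperFilter_ex.
    by move=> A [N NA]; have [n Nn Sn] := Sinf N; exists n; exact: NA.
  split; first by exists 0%N.
  - move=> A A' [N NA] [N' NA']; exists (maxn N N') => n; rewrite geq_max => /andP[Nn N'n] Sn.
    by split; [exact: NA|exact: NA'].
  - by move=> A A' AA' [N NA]; exists N => n Nn Sn; apply/AA'/NA.
have [U [UU GU]] := ultraFilterLemma GP.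
have [f fP] := choice (fun t => ultrafilter_limit UU (fun n => uB n t)).
exists f => ts M N e e0.
suff UM : U [set n | forall j, (j < M)%N -> `|u n (ts j) - f (ts j)| < e].
  have UN : U [set n | (N <= n)%N /\ S n] by apply: GU; exists N.
  by have [n [[Nn Sn] hn]] := filter_ex (filterI UN UM); exists n.
elim: M => [|M IH]; first by apply: filterS filterT.
apply: filterS (filterI IH (fP (ts M) e e0)) => n [/= hn hM] j.
by rewrite ltnS leq_eqVlt => /predU1P[->|/hn].
Qed.

(** * Seminorms, norming functionals and triangular systems *)

Section Seminorms.
Variables (R : realType) (V : lmodType R).
Implicit Types (p f g : V -> R).

Definition seminorm p : Prop :=
  (forall x y, p (x + y) <= p x + p y) /\ (forall a x, p (a *: x) = `|a| * p x).

Definition dual_ball p f : Prop := scalar f /\ forall x, `|f x| <= p x.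

Definition infinite_rank p : Prop :=
  ~ exists (n : nat) (e : 'I_n -> V),
      forall x, exists c : 'I_n -> R, p (x - \sum_(i < n) c i *: e i) = 0.

Lemma scalarfD f : scalar f -> {morph f : x y / x + y}.
Proof. by move=> fl x y; have := fl 1 x y; rewrite scale1r mul1r. Qed.

Lemma scalarf0 f : scalar f -> f 0 = 0.
Proof. by move=> fl; have := scalarfD fl 0 0; rewrite addr0; lra. Qed.

Lemma scalarfZ f : scalar f -> forall a x, f (a *: x) = a * f x.
Proof. by move=> fl a x; have := fl a x 0; rewrite !addr0 (scalarf0 fl) addr0. Qed.

Lemma scalarfN f : scalar f -> {morph f : x / - x}.
Proof. by move=> fl x; rewrite -scaleN1r (scalarfZ fl) mulN1r. Qed.

Lemma scalarfB f : scalar f -> {morph f : x y / x - y}.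
Proof. by move=> fl x y; rewrite (scalarfD fl) (scalarfN fl). Qed.

Lemma scalar_combination f g a b : scalar f -> scalar g ->
  scalar (fun x => a * f x + b * g x).
Proof. by move=> fl gl c x y; rewrite fl gl; ring. Qed.

Lemma seminorm0 p : seminorm p -> p 0 = 0.
Proof. by move=> ps; rewrite -(scale0r 0) ps.2 normr0 mul0r. Qed.

Lemma seminormN p x : seminorm p -> p (- x) = p x.
Proof. by move=> ps; rewrite -scaleN1r ps.2 normrN1 mul1r. Qed.

Lemma seminorm_ge0 p x : seminorm p -> 0 <= p x.
Proof.
move=> ps; have := ps.1 x (- x); rewrite subrr (seminorm0 ps) (seminormN _ ps).
lra.
Qed.

Lemma seminorm_sublinear p c : seminorm p -> 0 <= c -> sublinear (fun x => c * p x).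
Proof.
move=> ps c0; split=> [x y|t x t0]; first by rewrite -mulrDr ler_wpM2l// ps.1.
by rewrite ps.2 gtr0_norm// mulrCA.
Qed.

Lemma scalar_le_abs p f : seminorm p -> scalar f -> (forall x, f x <= p x) -> dual_ball p f.
Proof.
move=> ps fl fp; split=> // x; rewrite ler_norml fp andbT lerNl -(scalarfN fl).
by rewrite -(seminormN x ps).
Qed.

Lemma hahn_banach_norming p x : seminorm p ->
  exists2 f, dual_ball p f & f x = p x.
Proof.
move=> ps; pose S : set (V * R) := [set u | exists2 t, 0 <= t & u = (t *: x, t * p x)].
have [| | | | |f [fl fp fS]] := @hahn_banach_cone R V p S.
- by have := seminorm_sublinear ps ler01; under eq_fun do rewrite mul1r.
- by exists 0; rewrite ?scale0r ?mul0r.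
- move=> u v [t t0 ->] [s s0 ->]; exists (t + s); first exact: addr_ge0.
  by rewrite /= scalerDl mulrDl.
- move=> t u t0 [s s0 ->]; exists (t * s); first by rewrite mulr_ge0// ltW.
  by rewrite /= scalerA mulrA.
- by move=> u [t t0 ->] /=; rewrite ps.2 ger0_norm.
- exists f; first exact: scalar_le_abs.
  apply/eqP; rewrite eq_le fp /=.
  by apply: (fS (x, p x)); exists 1; rewrite ?scale1r ?mul1r.
Qed.

(** The cone is the graph of [f] over [W]; being stable under opposites, it forces equality on
    [W]. *)
Lemma hahn_banach_subspace p c f (W : set V) : seminorm p -> 0 <= c -> scalar f ->
  W 0 -> (forall a x y, W x -> W y -> W (a *: x + y)) ->
  (forall x, W x -> f x <= c * p x) ->
  exists g, [/\ scalar g, forall x, `|g x| <= c * p x & forall x, W x -> g x = f x].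
Proof.
move=> ps c0 fl W0 WL Wf.
have qs : seminorm (fun x => c * p x).
  split=> [x y|a x]; first by rewrite -mulrDr ler_wpM2l// ps.1.
  by rewrite ps.2 mulrCA.
have WN x : W x -> W (- x) by move=> Wx; rewrite -[- x]addr0 -scaleN1r; exact: WL.
pose S : set (V * R) := [set u | W u.1 /\ u.2 = f u.1].
have [| | | | |g [gl gp gS]] := @hahn_banach_cone R V (fun x => c * p x) S.
- exact: seminorm_sublinear.
- by split=> //=; rewrite (scalarf0 fl).
- move=> u v [Wu ->] [Wv ->]; split=> /=; last by rewrite (scalarfD fl).
  by rewrite -[u.1]scale1r; exact: WL.
- move=> t u t0 [Wu ->]; split=> /=; last by rewrite (scalarfZ fl).
  by rewrite -[t *: _]addr0; exact: WL.
- by move=> u [Wu ->]; exact: Wf.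
- exists g; split=> //; first by case: (scalar_le_abs qs gl gp).
  move=> x Wx; apply/eqP; rewrite eq_le (gS (x, f x))// andbT.
  have := gS (- x, f (- x)) (conj (WN _ Wx) erefl).
  by rewrite /= (scalarfN fl) (scalarfN gl); lra.
Qed.

(** Induction on [N]: either a vector killed by the earlier functionals but not by [h N] tells which
    multiple of [h N] to subtract from [f], or [h N] already vanishes on the common kernel of the
    earlier ones. *)
Lemma vanish_on_kernels f (h : nat -> V -> R) N : scalar f ->
  (forall i, scalar (h i)) ->
  (forall x, (forall i, (i < N)%N -> h i x = 0) -> f x = 0) ->
  exists c : nat -> R, forall x, f x = \sum_(i < N) c i * h i x.
Proof.
elim: N f => [|N IH] f fl hl fv.
  by exists (fun=> 0) => x; rewrite big_ord0; exact: fv.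
have [[y yN hy]|nh] := pselect (exists2 y, (forall i, (i < N)%N -> h i y = 0) & h N y != 0).
- pose b := f y / h N y; pose f' x := 1 * f x + (- b) * h N x.
  have [|//|x xN|c fc] := IH f'.
  + exact: scalar_combination.
  + have := fv (x - (h N x / h N y) *: y); rewrite (scalarfB fl) (scalarfZ fl) => fv'.
    rewrite /f' mul1r -[RHS]fv' /b; first by field.
    move=> i; rewrite ltnS leq_eqVlt (scalarfB (hl i)) (scalarfZ (hl i)).
    by case/predU1P => [->|iN]; [field|rewrite (xN i)// (yN i)// mulr0 subr0].
  + exists (fun i => if (i < N)%N then c i else b) => x.
    rewrite big_ord_recr /= ltnn.
    under eq_bigr do rewrite ltn_ord.
    rewrite -fc /f'; ring.
- have [//|//|x xN|c fc] := IH f.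
  + apply: fv => i; rewrite ltnS leq_eqVlt => /predU1P[->|/xN//].
    by apply/eqP/negPn/negP => hx; apply: nh; exists x.
  + exists (fun i => if (i < N)%N then c i else 0) => x.
    rewrite big_ord_recr /= ltnn mul0r addr0 fc.
    by apply: eq_bigr => i _; rewrite ltn_ord.
Qed.

(** By infinite rank some vector keeps a nonzero seminorm whatever combination of the earlier [e i]
    is subtracted. Subtract the one that makes the earlier [h i] vanish, normalise, and take a
    norming functional. *)
Lemma triangular_system p : seminorm p -> infinite_rank p ->
  exists (h : nat -> V -> R) (e : nat -> V),
    [/\ forall n, dual_ball p (h n), forall n, p (e n) <= 1,
        forall n, h n (e n) = 1 & forall i n, (i < n)%N -> h i (e n) = 0].
Proof.
move=> ps pinf.
pose d : (V -> R) * V := (fun=> 0, 0).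
pose P l := forall i, (i < size l)%N ->
  [/\ dual_ball p (nth d l i).1, p (nth d l i).2 <= 1,
      (nth d l i).1 (nth d l i).2 = 1 &
      forall j, (j < i)%N -> (nth d l j).1 (nth d l i).2 = 0].
have [//|l Pl|s sP] := @extend_seq _ P; last first.
  have sP' n i : (i < n)%N -> _ := fun h => sP n i (etrans (congr1 (leq i.+1) (size_mkseq s n)) h).
  exists (fun n => (s n).1), (fun n => (s n).2); split=> [n|n|n|i n lin].
  - by have [] := sP' _ _ (ltnSn n); rewrite !nth_mkseq.
  - by have [] := sP' _ _ (ltnSn n); rewrite !nth_mkseq.
  - by have [] := sP' _ _ (ltnSn n); rewrite !nth_mkseq.
  - have [_ _ _ /(_ i lin)] := sP' _ _ (ltnSn n).
    by rewrite !nth_mkseq// ltnS ltnW.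
pose h i := (nth d l i).1; pose e i := (nth d l i).2.
have [x xP] : exists x, forall c : 'I_(size l) -> R, p (x - \sum_(i < size l) c i *: e i) != 0.
  apply: contrapT => nx; apply: pinf; exists (size l), (fun i => e i) => x.
  apply: contrapT => nc; apply: nx; exists x => c.
  by apply/negP => /eqP c0; apply: nc; exists c.
have [c cP] : exists c : nat -> R, forall i, (i < size l)%N ->
    h i (x - \sum_(i < size l) c i *: e i) = 0.
  (* Forward substitution: [e N] is killed by the [h i] with [i < N] and has value 1 under [h N], so
     its coefficient does not disturb the earlier equations. *)
  suff : forall N, (N <= size l)%N -> exists c : nat -> R, forall i, (i < N)%N ->
      h i (x - \sum_(i < N) c i *: e i) = 0 by exact.
  elim=> [|N IH] Nl; first by exists (fun=> 0).
  have [c cN] := IH (ltnW Nl).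
  pose y := x - \sum_(i < N) c i *: e i.
  exists (fun i => if (i < N)%N then c i else h N y) => i iN.
  rewrite big_ord_recr /= ltnn.
  under eq_bigr do rewrite ltn_ord.
  rewrite opprD addrA -/y.
  have il : (i < size l)%N by exact: leq_trans iN Nl.
  have hl : scalar (h i) by case: (Pl _ il) => [[]].
  rewrite (scalarfB hl) (scalarfZ hl); have [_ _ h1 h0] := Pl _ Nl.
  move: iN; rewrite ltnS leq_eqVlt => /predU1P[iN|iN].
    by rewrite iN [X in _ - _ * X]h1 mulr1 subrr.
  by rewrite -/(h i) cN// sub0r [X in _ * X](h0 i iN) mulr0 oppr0.
pose y := x - \sum_(i < size l) c i *: e i.
have y0 : 0 < p y by rewrite lt_neqAle eq_sym xP seminorm_ge0.
pose e' := (p y)^-1 *: y.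
have e'1 : p e' = 1 by rewrite /e' ps.2 gtr0_norm ?invr_gt0// mulVf// gt_eqF.
have [f fd fe'] := hahn_banach_norming e' ps.
exists (f, e') => i; rewrite size_rcons ltnS leq_eqVlt => /predU1P[->|il].
  rewrite nth_rcons ltnn eqxx /=; split; rewrite ?e'1 ?fe'//.
  move=> j jl; rewrite nth_rcons jl; have [[hl _] _ _ _] := Pl _ jl.
  by rewrite /e' (scalarfZ hl) [X in _ * X](cP j jl) mulr0.
have [h1 h2 h3 h4] := Pl _ il; rewrite nth_rcons il; split=> // j ji.
by rewrite nth_rcons (ltn_trans ji il) h4.
Qed.

End Seminorms.

(** * Approximate Josefson-Nissenzweig *)

Section WeakJosefsonNissenzweig.
Variables (R : realType) (V : lmodType R) (p : V -> R).
Hypothesis ps : seminorm p.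

(** The Josefson-Nissenzweig theorem asks for pointwise limit 0; here functionals of norm at least 1
    only have to end within [eps] of 0 at each vector of the ball. *)
Definition almost_weak_star_null (eps : R) : Prop :=
  exists h : nat -> V -> R,
    [/\ forall n, scalar (h n),
        exists C, forall n x, `|h n x| <= C * p x,
        forall n, exists2 x, p x <= 1 & 1 <= h n x &
        forall x, p x <= 1 -> exists N, forall n, (N <= n)%N -> `|h n x| <= eps].

Lemma almost_weak_star_null_rescale eps delta (d : nat -> V -> R) : 0 < delta ->
  (forall n, scalar (d n)) -> (exists C, forall n x, `|d n x| <= C * p x) ->
  (forall n, exists2 x, p x <= 1 & delta <= `|d n x|) ->
  (forall x, p x <= 1 -> exists N, forall n, (N <= n)%N -> `|d n x| <= eps * delta) ->
  almost_weak_star_null eps.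
Proof.
move=> delta0 dl [C dC] dn dlim; have di : 0 < delta^-1 by rewrite invr_gt0.
exists (fun n x => delta^-1 * d n x); split=> [n|||].
- by move=> a x y; rewrite dl; ring.
- exists (delta^-1 * C) => n x; rewrite normrM gtr0_norm// -mulrA.
  by rewrite ler_wpM2l// ltW.
- move=> n; have [x x1 dx] := dn n.
  have [dx0|dx0] := leP 0 (d n x); [exists x => //|exists (- x)].
  + by rewrite ler_pdivlMl// mulr1 -[d n x]ger0_norm.
  + by rewrite (seminormN _ ps).
  + by rewrite (scalarfN (dl n)) ler_pdivlMl// mulr1 -[- d n x]ltr0_norm.
- move=> x /dlim[N hN]; exists N => n /hN; rewrite normrM gtr0_norm// ler_pdivrMl//.
  by rewrite mulrC.
Qed.

Lemma bounded_partial_sums (a : nat -> R) (B c : R) : 0 < c ->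
  (forall j, 0 <= a j) -> (forall M, \sum_(j < M) a j <= B) ->
  exists N, forall n, (N <= n)%N -> a n <= c.
Proof.
move=> c0 a0 aB; apply: contrapT => nN.
have {}nN N : exists2 n, (N <= n)%N & c < a n.
  apply: contrapT => h; apply: nN; exists N => n Nn; rewrite leNgt; apply/negP => ?.
  by apply: h; exists n.
have ht t : exists M, t%:R * c <= \sum_(j < M) a j.
  elim: t => [|t [M hM]]; first by exists 0%N; rewrite big_ord0 mul0r.
  have [n Mn cn] := nN M; exists n.+1; rewrite big_ord_recr /= -natr1 mulrDl mul1r.
  apply: lerD (ltW cn); apply: le_trans hM _.
  rewrite -[leLHS](big_mkord xpredT a) -[leRHS](big_mkord xpredT a).
  rewrite [leRHS](big_cat_nat (n := M))//=.
  by rewrite lerDl sumr_ge0.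
have [M] := ht (Num.trunc (B / c)).+1; apply/negP; rewrite -ltNge.
by apply: le_lt_trans (aB M) _; rewrite -ltr_pdivrMr// truncnS_gt.
Qed.

(** The factor 2 is there because the supremum over the ball need not be attained. *)
Lemma norming_vector g C : scalar g -> (forall x, `|g x| <= C * p x) ->
  exists2 y, p y <= 1 & forall x, p x <= 1 -> `|g x| <= 2 * `|g y|.
Proof.
move=> gl gC.
have [[x0 x01 gx0]|ng] := pselect (exists2 x, p x <= 1 & g x != 0); last first.
  exists 0; first by rewrite (seminorm0 ps).
  move=> x x1; suff -> : g x = 0 by rewrite normr0 mulr_ge0.
  by apply/eqP/negPn/negP => gx; apply: ng; exists x.
pose E := [set `|g x| | x in [set x | p x <= 1]].
have Eub : has_ubound E.
  exists `|C| => _ [x x1 <-]; apply: le_trans (gC x) _.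
  apply: le_trans (ler_norm _) _; rewrite normrM [`|p x|]ger0_norm ?seminorm_ge0//.
  by rewrite ler_piMr.
have Esup : has_sup E by split=> //; exists `|g x0|, x0.
have supE0 : 0 < sup E.
  have : `|g x0| <= sup E by apply: ub_le_sup => //; exists x0.
  by apply: lt_le_trans; rewrite normr_gt0.
have h20 : 0 < sup E / 2 by rewrite divr_gt0.
have [_ [y y1 <-] hy] := sup_adherent h20 Esup.
exists y => // x x1; have : `|g x| <= sup E by apply: ub_le_sup => //; exists x.
by lra.
Qed.

(** A weak-star cluster point of [h]: the first [M] terms of [xs] and the number [e] describe a
    basic neighbourhood. *)
Definition cluster_functional (h : nat -> V -> R) (f : V -> R) : Prop :=
  forall (xs : nat -> V) M N e, 0 < e ->
    exists2 n, (N <= n)%N & forall j, (j < M)%N -> `|h n (xs j) - f (xs j)| < e.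

Lemma cluster_functional_dual_ball h f : (forall n, dual_ball p (h n)) ->
  cluster_functional h f -> dual_ball p f.
Proof.
move=> hd hf; split=> [a x y|x].
- apply/eqP; rewrite -subr_eq0 -normr_le0; apply/ler_addgt0Pl => e e0; rewrite addr0.
  have c0 : 0 < 2 + `|a| by rewrite ltr_wpDr.
  have [n _ hn] := hf (nth 0 [:: a *: x + y; x; y]) 3%N 0%N _ (divr_gt0 e0 c0).
  have := hn 0%N isT; have := hn 1%N isT; have := hn 2%N isT => /=.
  rewrite (hd n).1; set u := h n x; set v := h n y; set eta := e / _ => hy hx hxy.
  have -> : f (a *: x + y) - (a * f x + f y) =
    (v - f y) + a * (u - f x) - (a * u + v - f (a *: x + y)) by ring.
  apply: le_trans (ler_normB _ _) _.
  apply: le_trans (lerD (ler_normD _ _) (lexx _)) _; rewrite normrM.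
  have -> : e = eta + `|a| * eta + eta by rewrite /eta; field; rewrite gt_eqF.
  by rewrite !lerD ?ler_wpM2l// ltW.
- apply/ler_addgt0Pl => e e0.
  have [n _ /(_ 0%N isT) /= hn] := hf (fun=> x) 1%N 0%N _ e0.
  have := (hd n).2 x; have := ler_normB (h n x) (h n x - f x).
  rewrite opprB addrC subrK; lra.
Qed.

Variables (h : nat -> V -> R) (e : nat -> V).
Hypotheses (hd : forall n, dual_ball p (h n)) (e1 : forall n, p (e n) <= 1).
Hypotheses (he1 : forall n, h n (e n) = 1).
Hypotheses (he0 : forall i n, (i < n)%N -> h i (e n) = 0).

(** Rational coefficients keep the combinations countable, on which the diagonal choice of a
    subsequence relies. *)
Let comb (c : seq rat) (x : V) : R := \sum_(j < size c) ratr c`_j * h j x.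

Let comb_scalar c : scalar (comb c).
Proof.
move=> a x y; rewrite /comb mulr_sumr -big_split; apply: eq_bigr => j _.
by rewrite (hd j).1 /=; ring.
Qed.

Let comb_bounded c x : `|comb c x| <= (\sum_(j < size c) `|ratr c`_j : R|) * p x.
Proof.
apply: le_trans (ler_norm_sum _ _ _) _; rewrite mulr_suml; apply: ler_sum => j _.
by rewrite normrM ler_wpM2l// (hd j).2.
Qed.

(** A subsequence converges to a cluster functional [f0] on countably many vectors that nearly norm
    the differences of rational combinations. Any cluster functional of the subsequence agrees with
    [f0] there, and both are close to combinations, so they are close on the whole ball. Hence the
    subsequence minus [f0] is almost null. *)
Lemma almost_weak_star_null_near_span theta : 0 < theta ->
  (forall f, dual_ball p f -> cluster_functional h f ->
     exists c, forall x, `|f x - comb c x| <= theta * p x) ->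
  almost_weak_star_null (14 * theta).
Proof.
move=> theta0 near_span.
have [y0 y0P] : exists y : seq rat * seq rat -> V, forall cc, p (y cc) <= 1 /\
    forall x, p x <= 1 -> `|comb cc.1 x - comb cc.2 x| <=
      2 * `|comb cc.1 (y cc) - comb cc.2 (y cc)|.
  suff /choice[y yP] : forall cc : seq rat * seq rat, exists y, p y <= 1 /\
      forall x, p x <= 1 -> `|comb cc.1 x - comb cc.2 x| <=
        2 * `|comb cc.1 y - comb cc.2 y| by exists y.
  move=> [c c'] /=.
  have [||y y1 yn] := @norming_vector (fun x => comb c x - comb c' x)
      (\sum_(j < size c) `|ratr c`_j : R| + \sum_(j < size c') `|ratr c'`_j : R|).
  - by move=> a x z; rewrite !comb_scalar; ring.
  - move=> x; apply: le_trans (ler_normB _ _) _; rewrite mulrDl.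
    by apply: lerD; exact: comb_bounded.
  - by exists y.
pose ys j : V := if unpickle j is Some cc then y0 cc else 0.
have hB n x : `|h n x| <= p x by case: (hd n).
have [f0 f0P] := @pointwise_cluster R V h p setT hB (fun N => ex_intro2 _ _ N (leqnn N) I).
have f0c : cluster_functional h f0.
  by move=> xs M N eta eta0; have [n [Nn _ hn]] := f0P xs M N _ eta0; exists n.
have f0d := cluster_functional_dual_ball hd f0c.
have k0 (k : nat) : 0 < k.+1%:R^-1 :> R by rewrite invr_gt0.
have /choice[nu nuP] : forall k : nat, exists n : nat, (k <= n)%N /\
    forall j, (j < k)%N -> `|h n (ys j) - f0 (ys j)| < k.+1%:R^-1.
  by move=> k; have [n kn hn] := f0c ys k k _ (k0 k); exists n.
(* If some [h (nu k1) - f0] is below 1/2 on the ball, then so is [f0] at every later [e (nu k)],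
   where [h (nu k)] equals 1. *)
have [K KP] : exists K, forall k, (K <= k)%N ->
    exists2 x, p x <= 1 & 2^-1 <= `|h (nu k) x - f0 x|.
  have [[k1 hk1]|nk] := pselect
      (exists k1, forall x, p x <= 1 -> `|h (nu k1) x - f0 x| < 2^-1).
    exists (nu k1).+1 => k k1k; exists (e (nu k)) => //.
    have k1nu : (nu k1 < nu k)%N by apply: leq_trans k1k (nuP k).1.
    have := hk1 _ (e1 (nu k)); rewrite (he0 k1nu) sub0r normrN he1 => f0e.
    have := ler_normB 1 (1 - f0 (e (nu k))); rewrite opprB addrC subrK normr1.
    by have := ler_norm (f0 (e (nu k))); have := ler_norm (1 - f0 (e (nu k))); lra.
  exists 0%N => k _; apply: contrapT => nx; apply: nk; exists k => x x1.
  by rewrite ltNge; apply/negP => ?; apply: nx; exists x.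
apply: (@almost_weak_star_null_rescale _ 2^-1 (fun k x => h (nu (K + k)%N) x - f0 x)).
- by rewrite invr_gt0.
- by move=> n a x z; rewrite (hd _).1 f0d.1; ring.
- exists 2 => n x; apply: le_trans (ler_normB _ _) _.
  by have := (hd (nu (K + n)%N)).2 x; have := f0d.2 x; lra.
- by move=> n; apply: KP; exact: leq_addr.
move=> x x1; apply: contrapT => nN.
pose S := [set k | 7 * theta < `|h (nu k) x - f0 x|].
have Sinf N : exists2 k, (N <= k)%N & S k.
  apply: contrapT => hN; apply: nN; exists N => n Nn.
  have -> : 14 * theta * 2^-1 = 7 * theta by field.
  rewrite leNgt; apply/negP => ?; apply: hN; exists (K + n)%N => //.
  by rewrite (leq_trans Nn)// leq_addl.
have [f1 f1P] := pointwise_cluster (fun k => hB (nu k)) Sinf.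
have f1c : cluster_functional h f1.
  move=> xs M N eta eta0; have [n [Nn _ hn]] := f1P xs M N _ eta0.
  by exists (nu n) => //; exact: leq_trans Nn (nuP n).1.
have f1d := cluster_functional_dual_ball hd f1c.
have f1x : 7 * theta <= `|f1 x - f0 x|.
  apply/ler_addgt0Pl => eta eta0; have [n [_ Sn /(_ 0%N isT) /= hn]] := f1P (fun=> x) 1%N 0%N _ eta0.
  have := ler_normD (h (nu n) x - f1 x) (f1 x - f0 x).
  rewrite addrA subrK; move: Sn; rewrite /S /=; lra.
have f1y cc : f1 (y0 cc) = f0 (y0 cc).
  apply/eqP; rewrite -subr_eq0 -normr_le0; apply/ler_addgt0Pl => eta eta0; rewrite addr0.
  (* Beyond the code of [cc], the vector [y0 cc] is among those tested in the choice of [nu n]; the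
     other bound brings the error of that choice below [eta / 2]. *)
  pose N0 := (maxn (pickle cc).+1 (Num.trunc (2 / eta))).
  have eta20 : 0 < eta / 2 by rewrite divr_gt0.
  have [n [+ _ /(_ 0%N isT) /= hn]] := f1P (fun=> y0 cc) 1%N N0 _ eta20.
  rewrite geq_max => /andP[ccn etan].
  have := (nuP n).2 _ ccn; rewrite /ys pickleK => hn0.
  have : n.+1%:R^-1 <= eta / 2.
    rewrite -[leRHS]invrK lef_pV2 ?posrE ?invr_gt0// invf_div.
    by apply: le_trans (ltW (truncnS_gt _)) _; rewrite ler_nat ltnS.
  have := ler_normB (h (nu n) (y0 cc) - f0 (y0 cc)) (h (nu n) (y0 cc) - f1 (y0 cc)).
  have -> : h (nu n) (y0 cc) - f0 (y0 cc) - (h (nu n) (y0 cc) - f1 (y0 cc)) =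
    f1 (y0 cc) - f0 (y0 cc) by ring.
  by move: (n.+1%:R^-1) hn0 => w; lra.
have [c0 c0P] := near_span _ f0d f0c.
have [c1 c1P] := near_span _ f1d f1c.
have [y1 /(_ x x1) /= H3] := y0P (c1, c0); set y := y0 (c1, c0) in y1 H3 *.
have near (f : V -> R) c z : p z <= 1 -> (forall x, `|f x - comb c x| <= theta * p x) ->
    `|f z - comb c z| <= theta.
  by move=> z1 /(_ z) H; apply: le_trans H _; rewrite ler_piMr// ltW.
have := near _ _ _ y1 c0P; have := near _ _ _ y1 c1P.
have := near _ _ _ x1 c0P; have := near _ _ _ x1 c1P.
move: f1x; rewrite [f1 y]f1y -/y !ler_norml.
move=> H1 /andP[? ?] /andP[? ?] /andP[? ?] /andP[? ?].
(* The errors grow from [2 * theta] at the nearly norming [y] to [4 * theta] at [x], then to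
   [6 * theta] for [f1 - f0], short of the assumed [7 * theta]. *)
have H2 : `|comb c1 y - comb c0 y| <= 2 * theta by rewrite ler_norml; lra.
have : `|comb c1 x - comb c0 x| <= 4 * theta by lra.
rewrite ler_norml => /andP[? ?].
have : `|f1 x - f0 x| <= 6 * theta by rewrite ler_norml; lra.
by lra.
Qed.

Lemma rational_coefficients (c : nat -> R) N theta : 0 < theta ->
  exists q : seq rat, forall x,
    `|\sum_(i < N) c i * h i x - comb q x| <= theta * p x.
Proof.
move=> theta0.
pose eta : R := theta / N.+1%:R.
have eta0 : 0 < eta by rewrite divr_gt0.
have /choice[q qP] : forall i, exists q : rat, `|c i - ratr q| <= eta.
  move=> i; have lt : c i - eta < c i + eta by lra.
  have [q] := rat_in_itvoo lt.
  by rewrite in_itv /= => /andP[? ?]; exists q; rewrite ler_norml; lra.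
exists (mkseq q N) => x; rewrite /comb size_mkseq -sumrB.
apply: le_trans (ler_norm_sum _ _ _) _.
apply: le_trans (_ : \sum_(i < N) eta * p x <= _).
  apply: ler_sum => i _; rewrite nth_mkseq// -mulrBl normrM.
  by apply: ler_pM => //; exact: (hd i).2.
rewrite sumr_const card_ord -mulr_natl mulrA ler_wpM2r ?(seminorm_ge0 _ ps)//.
by rewrite /eta mulrA ler_pdivrMr// mulrC ler_wpM2l ?(ltW theta0)// ler_nat.
Qed.

(* Away from the span of the [h n], a cluster functional [f] of [h] is separated
   from each finite set of them by a vector of the unit ball (Helly); this is
   the biorthogonal pattern of James' theorem on non-reflexive spaces. *)
Lemma james_pattern f theta : 0 < theta -> dual_ball p f -> cluster_functional h f ->
  (forall c, ~ forall x, `|f x - comb c x| <= theta * p x) ->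
  exists (g : nat -> V -> R) (X : nat -> V),
    [/\ forall k, dual_ball p (g k), forall m, p (X m) <= 1,
        forall m k, (m <= k)%N -> theta / 4 <= g k (X m) &
        forall k, exists M, forall m, (M <= m)%N -> g k (X m) = 0].
Proof.
move=> theta0 fd fc far.
have theta20 : 0 < theta / 2 by rewrite divr_gt0.
have /choice[X XP] : forall N, exists x, [/\ p x <= 1, theta / 2 <= f x &
    forall i, (i < N)%N -> h i x = 0].
  move=> N; apply: contrapT => nx.
  (* Otherwise [f] has norm at most [theta / 2] on [W], and its restriction extends to [g] with the
     same bound. Then [f - g] is a combination of the [h i], and rounding its coefficients costs
     another [theta / 2]. *)
  pose W : set V := [set x | forall i, (i < N)%N -> h i x = 0].
  have [|||g [gl gp gW]] := @hahn_banach_subspace R V p (theta / 2) f W ps (ltW theta20) fd.1.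
  - by move=> i _; rewrite (scalarf0 (hd i).1).
  - by move=> a x y Wx Wy i iN; rewrite (hd i).1 Wx// Wy// mulr0 addr0.
  - move=> x Wx; rewrite leNgt; apply/negP => fx.
    have px : 0 < p x.
      rewrite lt_neqAle seminorm_ge0// andbT; apply/eqP => px.
      have := fd.2 x; have := ler_norm (f x); move: fx; rewrite -px mulr0; lra.
    apply: nx; exists ((p x)^-1 *: x); split=> [||i iN].
    + by rewrite ps.2 ger0_norm ?invr_ge0 ?(ltW px)// mulVf// gt_eqF.
    + by rewrite (scalarfZ fd.1) ler_pdivlMl// mulrC ltW.
    + by rewrite (scalarfZ (hd i).1) Wx// mulr0.
  - have [| |x xW|c cP] := @vanish_on_kernels R V (fun x => 1 * f x + (-1) * g x) h N.
    + exact: scalar_combination fd.1 gl.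
    + by move=> i; case: (hd i).
    + by rewrite gW//; ring.
    + have [q qP] := rational_coefficients c N theta20.
      apply: (far q) => x; have := qP x; rewrite -cP; have := gp x.
      rewrite !ler_norml => /andP[? ?] /andP[? ?]; apply/andP; split; lra.
have theta40 : 0 < theta / 4 by rewrite divr_gt0.
(* [h (nu k)] inherits from [f] values of at least [theta / 2 - theta / 4] at [X 0], ..., [X k], and
   it kills [X m] once [m > nu k]. *)
have /choice[nu nuP] : forall k : nat, exists n : nat, forall j, (j < k.+1)%N ->
    `|h n (X j) - f (X j)| < theta / 4.
  by move=> k; have [n _ hn] := fc X k.+1 0%N _ theta40; exists n.
exists (fun k => h (nu k)), X; split=> // [m|m k mk|k].
- by case: (XP m).
- have := nuP k m; rewrite ltnS => /(_ mk); rewrite ltr_norml => /andP[? ?].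
  by have [_ ? _] := XP m; lra.
- by exists (nu k).+1 => m km; have [_ _] := XP m; apply.
Qed.

End WeakJosefsonNissenzweig.

(** * Iterated splitting of a James pattern *)

Section JamesSplitting.
Variables (R : realType) (V : lmodType R) (p : V -> R) (theta delta : R) (X : nat -> V).

(* [g k] and [r j k], [j < m], stand for the mean and the [m] Rademacher averages
   of [2 ^ m] functionals of the unit ball; the quadratic bound is Bessel's
   inequality.  A further vector [e] on which [g a - g b] is large for
   arbitrarily late [a] and [b] splits each of the [2 ^ m] functionals in two. *)
Definition splitting (m : nat) (g : nat -> V -> R) (r : nat -> nat -> V -> R)
    (E : nat -> V) : Prop :=
  (((forall k, scalar (g k)) /\ (forall j k, scalar (r j k))) /\
   (forall k x, g k x ^+ 2 + \sum_(j < m) r j k x ^+ 2 <= p x ^+ 2)) /\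
  [/\ forall i k, (i <= k)%N -> theta <= g k (X i),
      forall k, exists M, forall i, (M <= i)%N -> g k (X i) = 0 &
      forall j k, (j < m)%N -> delta <= r j k (E j)].

Lemma sq_mean_le (a b : R) : ((a + b) / 2) ^+ 2 <= (a ^+ 2 + b ^+ 2) / 2.
Proof. by have := sqr_ge0 (a - b); rewrite !expr2; lra. Qed.

(** The half sums replace [g] and the half differences become a new Rademacher average; by the
    parallelogram identity the quadratic bound survives. Since [a k] and [b k] are at least [k], so
    does the pattern on [X]. *)
Lemma splitting_step m g r E : splitting m g r E ->
  (exists2 e, p e <= 1 &
     forall k, exists a b, [/\ (k <= a)%N, (k <= b)%N & 2 * delta <= g a e - g b e]) ->
  exists2 e, p e <= 1 &
    exists g' r', splitting m.+1 g' r' (fun j => if (j < m)%N then E j else e).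
Proof.
move=> [[[gl rl] gr] [gX gX0 rE]] [e e1 /choice[a /choice[b ab]]]; exists e => //.
pose g' k x := (g (a k) x + g (b k) x) / 2.
pose r' j k x := if (j < m)%N then (r j (a k) x + r j (b k) x) / 2
  else (g (a k) x - g (b k) x) / 2.
exists g', r'; split; last split.
- split; first split=> [k|j k].
  + by move=> c x y; rewrite /g' !(gl _ c x y); field.
  + by move=> c x y; rewrite /r'; case: ifP => _; rewrite ?(rl _ _ c x y) ?(gl _ c x y); field.
  + move=> k x; rewrite big_ord_recr /= /r' ltnn.
    under eq_bigr do rewrite ltn_ord.
    have H : \sum_(j < m) ((r j (a k) x + r j (b k) x) / 2) ^+ 2 <=
        (\sum_(j < m) r j (a k) x ^+ 2 + \sum_(j < m) r j (b k) x ^+ 2) / 2.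
      rewrite -big_split mulr_suml; apply: ler_sum => j _; exact: sq_mean_le.
    have := gr (a k) x; have := gr (b k) x; have := sq_mean_le (g (a k) x) (g (b k) x).
    have -> : ((g (a k) x - g (b k) x) / 2) ^+ 2 =
        (g (a k) x ^+ 2 + g (b k) x ^+ 2) / 2 - g' k x ^+ 2 by rewrite /g'; field.
    lra.
- move=> i k ik; have [ka kb _] := ab k.
  by have := gX i _ (leq_trans ik ka); have := gX i _ (leq_trans ik kb); rewrite /g'; lra.
- move=> k; have [M HM] := gX0 (a k); have [M' HM'] := gX0 (b k).
  exists (maxn M M') => i; rewrite geq_max => /andP[Mi M'i].
  by rewrite /g' HM// HM'// addr0 mul0r.
- move=> j k; rewrite /r' ltnS => jm; have [ka kb hab] := ab k.
  case: (boolP (j < m)%N) => [jm'|_]; last by lra.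
  by have := rE j (a k) jm'; have := rE j (b k) jm'; lra.
Qed.

End JamesSplitting.

Section JosefsonNissenzweig.
Variables (R : realType) (V : lmodType R) (p : V -> R).
Hypothesis ps : seminorm p.

(** The vectors [E] are fixed one after the other, but the functionals change at each stage;
    compactness, applied to pairs of an index and a vector, gives limits for all indices at once. *)
Lemma splitting_system theta delta X :
  (exists2 g : nat -> V -> R, forall k, dual_ball p (g k) &
    (forall i k, (i <= k)%N -> theta <= g k (X i)) /\
    forall k, exists M, forall i, (M <= i)%N -> g k (X i) = 0) ->
  (forall m g r E, splitting p theta delta X m g r E -> exists2 e, p e <= 1 &
     forall k, exists a b, [/\ (k <= a)%N, (k <= b)%N & 2 * delta <= g a e - g b e]) ->
  exists (f : nat -> V -> R) (E : nat -> V),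
    [/\ forall j, dual_ball p (f j), forall j, p (E j) <= 1,
        forall j, delta <= f j (E j) &
        forall M x, \sum_(j < M) f j x ^+ 2 <= p x ^+ 2].
Proof.
move=> [g0 g0d [g0X g0X0]] split_all.
pose P (l : seq V) := (forall j, p (nth 0 l j) <= 1) /\
  exists g r, splitting p theta delta X (size l) g r (nth 0 l).
have [|l [l1 [g [r lP]]]|E EP] := @extend_seq _ P.
- split; first by move=> j; rewrite nth_nil (seminorm0 ps).
  exists g0, (fun _ _ _ => 0); split; last by split.
  split; first split=> [k|j k a x y]; first by case: (g0d k).
    by rewrite mulr0 addr0.
  move=> k x; rewrite big_ord0 addr0 -real_normK ?num_real//.
  by rewrite ler_pXn2r ?nnegrE ?(seminorm_ge0 _ ps)//; case: (g0d k).
- have [e e1 [g' [r' gr']]] := splitting_step lP (split_all _ _ _ _ lP).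
  exists e; split.
    move=> j; rewrite nth_rcons; case: ifP => // _; case: ifP => // _.
    by rewrite (seminorm0 ps).
  exists g', r'; rewrite size_rcons; case: gr' => H1 [H2 H3 H4]; split=> //; split=> //.
  move=> j k jl; have := H4 j k jl; rewrite nth_rcons; case: ifP => // jl'.
  by have -> : j == size l by apply/eqP; lia.
have E1 j : p (E j) <= 1.
  by have := (EP j.+1).1 j; rewrite nth_mkseq.
have /choice[r rP] : forall N, exists r : nat -> V -> R,
    [/\ forall j, scalar (r j), forall x, \sum_(j < N) r j x ^+ 2 <= p x ^+ 2 &
        forall j, (j < N)%N -> delta <= r j (E j)].
  move=> N; have [_ [g [r]]] := EP N; rewrite size_mkseq => -[[[gl rl] gr] [_ _ rE]].
  exists (fun j => r j 0%N); split=> // [x|j jN].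
    by apply: le_trans (gr 0%N x); rewrite lerDr sqr_ge0.
  by have := rE j 0%N jN; rewrite nth_mkseq.
have rp N j x : (j < N)%N -> `|r N j x| <= p x.
  move=> jN; have [_ /(_ x) h _] := rP N.
  rewrite -(@ler_pXn2r _ 2) ?nnegrE ?(seminorm_ge0 _ ps)// real_normK ?num_real//.
  apply: le_trans h; rewrite (bigD1 (Ordinal jN))//= lerDl.
  by apply: sumr_ge0 => i _; exact: sqr_ge0.
pose u N (t : nat * V) := if (t.1 < N)%N then r N t.1 t.2 else 0.
have up N t : `|u N t| <= p t.2.
  by rewrite /u; case: ifP => [/rp//|_]; rewrite normr0 seminorm_ge0.
have [f fP] := pointwise_cluster up (fun N => ex_intro2 _ _ N (leqnn N) (I : setT N)).
have fd j : dual_ball p (fun x => f (j, x)).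
  apply: (@cluster_functional_dual_ball _ _ _ (fun N => r (N + j.+1)%N j)).
    move=> N; split; first by case: (rP (N + j.+1)%N).
    by move=> x; apply: rp; rewrite addnS ltnS leq_addl.
  move=> xs M N e e0; have [n [Nn _ hn]] := fP (fun i => (j, xs i)) M (N + j.+1)%N e e0.
  exists (n - j.+1)%N; first by rewrite leq_subRL ?(leq_trans _ Nn)// ?leq_addl// addnC.
  move=> i iM; have jn : (j < n)%N by rewrite (leq_trans _ Nn)// addnS ltnS leq_addl.
  by have := hn i iM; rewrite /u /= jn subnK.
exists (fun j x => f (j, x)), E; split=> // [j|M x].
- apply/ler_addgt0Pl => e e0.
  have [n [jn _ /(_ 0%N isT) /= hn]] := fP (fun=> (j, E j)) 1%N j.+1 _ e0.
  have [_ _ /(_ j jn) rd] := rP n; move: hn; rewrite /u /= jn ltr_norml; lra.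
- apply/ler_addgt0Pl => e e0.
  (* The summand 1 keeps the denominator positive; as [|b + a| <= 2 * p x], passing from [a ^+ 2] to
     [b ^+ 2] costs at most [e / M.+1%:R]. *)
  have d0 : 0 < M.+1%:R * (1 + 2 * p x).
    by rewrite mulr_gt0// ltr_wpDr// mulr_ge0// seminorm_ge0.
  have [n [Mn _ hn]] := fP (fun j => (j, x)) M M _ (divr_gt0 e0 d0).
  have [_ /(_ x) rn _] := rP n.
  apply: le_trans (_ : \sum_(j < M) (r n j x ^+ 2 + e / M.+1%:R) <= _).
    apply: ler_sum => j _; have jn : (j < n)%N by exact: leq_trans Mn.
    have := hn j (ltn_ord j); rewrite /u /= jn; set a := r n j x; set b := f _.
    set eta := e / (_ * _) => hab.
    have pa : `|a| <= p x by exact: rp.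
    have pb : `|b| <= p x by exact: (fd j).2 x.
    have -> : b ^+ 2 = a ^+ 2 + (b - a) * (b + a) by ring.
    rewrite lerD2l; apply: le_trans (ler_norm _) _; rewrite normrM distrC.
    apply: le_trans (_ : eta * (1 + 2 * p x) <= _).
      apply: ler_pM => //; first exact: ltW.
      by apply: le_trans (ler_normD _ _) _; lra.
    have c0 : 0 < 1 + 2 * p x by rewrite ltr_wpDr// mulr_ge0// (seminorm_ge0 _ ps).
    by rewrite /eta invfM mulrA -mulrA mulVf ?mulr1// gt_eqF.
  rewrite big_split /= addrC; apply: lerD.
    rewrite sumr_const card_ord -[_ *+ M]mulr_natl mulrA ler_pdivrMr// mulrC.
    by rewrite ler_wpM2l ?(ltW e0)// ler_nat.
  apply: le_trans rn.
  rewrite -[leLHS](big_mkord xpredT (fun j => r n j x ^+ 2)).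
  rewrite -[leRHS](big_mkord xpredT (fun j => r n j x ^+ 2)) [leRHS](big_cat_nat (n := M))//=.
  by rewrite lerDl sumr_ge0// => i _; exact: sqr_ge0.
Qed.

Theorem weak_josefson_nissenzweig eps : infinite_rank p -> 0 < eps ->
  almost_weak_star_null p eps.
Proof.
move=> pinf eps0; apply: contrapT => nN.
have [h [e [hd e1 he1 he0]]] := triangular_system ps pinf.
have theta0 : 0 < eps / 14 by rewrite divr_gt0.
have [near|] := pselect (forall f, dual_ball p f -> cluster_functional h f ->
    exists c : seq rat, forall x,
      `|f x - \sum_(j < size c) ratr c`_j * h j x| <= eps / 14 * p x).
  apply: nN; have := almost_weak_star_null_near_span ps hd e1 he1 he0 theta0 near.
  by have -> : 14 * (eps / 14) = eps by field.
move=> /existsNP[f /not_implyP[fd /not_implyP[fc /forallNP far]]].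
have [g [X [gd X1 gX gX0]]] := james_pattern ps hd theta0 fd fc far.
set theta := eps / 14 / 4 in gX.
have th0 : 0 < theta by rewrite divr_gt0.
have [||f' [E [f'd E1 f'E f'2]]] :=
  @splitting_system theta (eps * theta / 2) X.
- by exists g.
- move=> m g' r' E' [[[gl' _] gr'] [gX' gX0' _]].
  have gp k x : `|g' k x| <= p x.
    rewrite -(@ler_pXn2r _ 2) ?nnegrE ?(seminorm_ge0 _ ps)// real_normK ?num_real//.
    apply: le_trans (gr' k x); rewrite lerDl.
    by apply: sumr_ge0 => i _; exact: sqr_ge0.
  have /choice[a aP] := gX0'.
  (* At [X (maxn (a i) i)] the first functional is at least [theta] and the second vanishes. So [d]
     has norms at least [theta], and as it is not almost null it exceeds [eps * theta] infinitely
     often at one vector. *)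
  pose d i x := g' (maxn (a i) i) x - g' i x.
  have [x x1 dx] : exists2 x, p x <= 1 & forall N, exists2 i, (N <= i)%N & eps * theta < `|d i x|.
    apply: contrapT => nx; apply: nN.
    apply: (@almost_weak_star_null_rescale _ _ _ ps _ theta d th0).
    + by move=> n c x y; rewrite /d !(gl' _ c x y); ring.
    + exists 2 => n x; apply: le_trans (ler_normB _ _) _.
      by have := gp (maxn (a n) n) x; have := gp n x; lra.
    + move=> n; exists (X (maxn (a n) n)) => //.
      rewrite /d (aP n)// ?leq_maxl// subr0; apply: le_trans (ler_norm _).
      exact: gX'.
    + move=> x x1; apply: contrapT => nM; apply: nx; exists x => // N.
      apply: contrapT => ni; apply: nM; exists N => n Nn.
      by rewrite leNgt; apply/negP => ?; apply: ni; exists n.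
  exists x => // k; have [i ki] := dx k; rewrite /d.
  have ka : (k <= maxn (a i) i)%N by rewrite leq_max ki orbT.
  rewrite ltr_normr => /orP[h1|h1].
  + by exists (maxn (a i) i), i; split=> //; lra.
  + by exists i, (maxn (a i) i); split=> //; lra.
apply: nN; have d0 : 0 < eps * theta / 2 by rewrite divr_gt0// mulr_gt0.
apply: (@almost_weak_star_null_rescale _ _ _ ps _ _ f' d0).
- by move=> n; case: (f'd n).
- by exists 1 => n x; rewrite mul1r; case: (f'd n).
- by move=> n; exists (E n) => //; apply: le_trans (f'E n) (ler_norm _).
- move=> x x1; have c0 : 0 < eps * (eps * theta / 2) by rewrite mulr_gt0.
  have [|||N HN] := @bounded_partial_sums R (fun j => f' j x ^+ 2) (p x ^+ 2)
    ((eps * (eps * theta / 2)) ^+ 2).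
  + by rewrite exprn_gt0.
  + by move=> j; exact: sqr_ge0.
  + by move=> M; exact: f'2.
  + exists N => n /HN; rewrite -[f' n x ^+ 2]real_normK ?num_real//.
    by rewrite ler_pXn2r ?nnegrE// ltW.
Qed.

End JosefsonNissenzweig.

(** * Dvoretzky-Rogers *)

Section DvoretzkyRogers.
Variables (R : realType) (V : lmodType R) (p : V -> R).
Hypothesis ps : seminorm p.

(** Equivalently, the combinations of the [v i] with coefficients in the Euclidean unit ball lie in
    the dual ball of [p]. *)
Definition ellipsoid m (v : 'I_m -> V -> R) : Prop :=
  (forall i, scalar (v i)) /\ forall x, \sum_i v i x ^+ 2 <= p x ^+ 2.

Definition transform m (M : 'M[R]_m) (v : 'I_m -> V -> R) : 'I_m -> V -> R :=
  fun i x => \sum_j M i j * v j x.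

(** The absolute value of its determinant measures the volume of the ellipsoid against the fixed
    vectors [e]. *)
Definition evaluation_mx m (v : 'I_m -> V -> R) (e : nat -> V) : 'M[R]_m :=
  \matrix_(i, l) v i (e l).

Lemma evaluation_mx_transform m (M : 'M[R]_m) v e :
  evaluation_mx (transform M v) e = M *m evaluation_mx v e.
Proof. by apply/matrixP => i l; rewrite !mxE; apply: eq_bigr => j _; rewrite mxE. Qed.

Lemma transform_scalar m (M : 'M[R]_m) v :
  (forall i, scalar (v i)) -> forall i, scalar (transform M v i).
Proof.
move=> vl i a x y; rewrite /transform mulr_sumr -big_split; apply: eq_bigr => j _.
by rewrite (vl j a x y) /=; ring.
Qed.

(** Householder reflection along [u]; for [u = 0] the convention [2 / 0 = 0] makes it the
    identity. *)
Definition reflection m (u : 'I_m -> R) : 'M[R]_m :=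
  \matrix_(a, b) ((a == b)%:R - 2 / (\sum_j u j ^+ 2) * u a * u b).

Lemma reflection_transform m (u : 'I_m -> R) v a x :
  transform (reflection u) v a x =
  v a x - 2 / (\sum_j u j ^+ 2) * u a * \sum_b u b * v b x.
Proof.
rewrite /transform; under eq_bigr do rewrite mxE mulrBl.
rewrite sumrB (bigD1 a)//= eqxx mul1r big1 ?addr0; last first.
  by move=> b ba; rewrite eq_sym (negbTE ba) mul0r.
by rewrite mulr_sumr; congr (_ - _); apply: eq_bigr => b _; rewrite mulrA.
Qed.

Lemma double_div_self (s : R) : 2 / s * (2 / s * s - 2) = 0.
Proof.
have [->|s0] := eqVneq s 0; first by rewrite invr0 mulr0 mul0r.
by rewrite divfK// subrr mulr0.
Qed.

Lemma reflection_isometry m (u : 'I_m -> R) v x :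
  \sum_a transform (reflection u) v a x ^+ 2 = \sum_a v a x ^+ 2.
Proof.
under eq_bigr do rewrite reflection_transform.
set s := \sum_b _ * _; set c := 2 / _.
transitivity (\sum_a v a x ^+ 2 + s ^+ 2 * (c * (c * (\sum_j u j ^+ 2) - 2))).
  have -> : s ^+ 2 * (c * (c * (\sum_j u j ^+ 2) - 2)) =
     \sum_j (s ^+ 2 * c ^+ 2 * u j ^+ 2 - 2 * s * c * (u j * v j x)).
    by rewrite sumrB -!mulr_sumr -/s; ring.
  by rewrite -big_split; apply: eq_bigr => a _ /=; ring.
by rewrite double_div_self mulr0 addr0.
Qed.

Lemma det_reflection m (u : 'I_m -> R) : `|\det (reflection u)| = 1.
Proof.
suff H : reflection u *m reflection u = 1%:M.
  have /eqP := congr1 determinant H; rewrite det_mulmx det1 -expr2 sqrf_eq1.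
  by case/orP => /eqP ->; rewrite ?normrN normr1.
apply/matrixP => a d.
transitivity (transform (reflection u) (fun b (_ : V) => reflection u b d) a 0).
  by rewrite !mxE.
rewrite reflection_transform.
set c := 2 / _.
have -> : \sum_b u b * reflection u b d = u d - c * (\sum_j u j ^+ 2) * u d.
  under eq_bigr do rewrite mxE mulrBr.
  rewrite sumrB (bigD1 d)//= eqxx mulr1 big1 ?addr0; last first.
    by move=> b /negbTE ->; rewrite mulr0.
  congr (_ - _); rewrite mulr_sumr mulr_suml; apply: eq_bigr => b _.
  by rewrite -/c; ring.
rewrite !mxE -/c; have := double_div_self (\sum_j u j ^+ 2); rewrite -/c.
move: (\sum_j _) => t ct.
have -> : (a == d)%:R - c * u a * u d - c * u a * (u d - c * t * u d) =
  (a == d)%:R + u a * u d * (c * (c * t - 2)) by ring.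
by rewrite ct mulr0 addr0.
Qed.

(** Here [u] is the tail of the coordinates from [i] on, minus [N] times the [i]-th unit vector,
    where [N] is the Euclidean norm of that tail. *)
Lemma reflect_onto m (v : 'I_m -> V -> R) (i : 'I_m) x :
  exists u : 'I_m -> R, (forall a : 'I_m, (a < i)%N -> u a = 0) /\
    transform (reflection u) v i x ^+ 2 = \sum_(j < m | (i <= j)%N) v j x ^+ 2.
Proof.
pose y (j : 'I_m) := if (i <= j)%N then v j x else 0.
have yE : \sum_(j < m | (i <= j)%N) v j x ^+ 2 = \sum_j y j ^+ 2.
  rewrite big_mkcond; apply: eq_bigr => j _; rewrite /y; case: ifP => //.
  by rewrite expr0n.
set q := \sum_(j | _) _ in yE *.
have q0 : 0 <= q by apply: sumr_ge0 => j _; exact: sqr_ge0.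
pose N := Num.sqrt q; have NN : N ^+ 2 = q by exact: sqr_sqrtr.
pose u (j : 'I_m) := y j - N * (j == i)%:R.
have sumi (f : 'I_m -> R) : \sum_j f j * (j == i)%:R = f i.
  rewrite (bigD1 i)//= eqxx mulr1 big1 ?addr0// => j /negbTE ->.
  by rewrite mulr0.
have yi : y i = v i x by rewrite /y leqnn.
exists u; split=> [a ai|].
  rewrite /u /y leqNgt ai /= (_ : a == i = false) ?mulr0 ?subr0//.
  by apply/negbTE; rewrite neq_ltn ai.
have uv : \sum_b u b * v b x = q - N * v i x.
  rewrite yE -yi -(sumi (fun j => N * y j)) -sumrB; apply: eq_bigr => b _.
  rewrite /u /y; case: ifP => ib; first by rewrite expr2; ring.
  have /negbTE -> : b != i by apply/negP => /eqP bi; rewrite bi leqnn in ib.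
  by rewrite mulr0n !mulr0; ring.
have uu : \sum_j u j ^+ 2 = 2 * (q - N * v i x).
  have -> : 2 * (q - N * v i x) = q - 2 * N * v i x + N ^+ 2 by rewrite NN; ring.
  rewrite yE -yi -(sumi (fun j => 2 * N * y j)) -(sumi (fun=> N ^+ 2)).
  rewrite -sumrB -big_split /=; apply: eq_bigr => j _; rewrite /u.
  by case: (j == i); rewrite /= ?mulr1 ?mulr0; ring.
rewrite reflection_transform uv; move: uu.
have ui : u i = v i x - N by rewrite /u yi eqxx mulr1.
move=> uu; rewrite -[RHS]NN; congr (_ ^+ 2).
(* The denominator vanishes exactly when [q = N * v i x]; then [u = 0] and [v i x] already equals
   [N]. *)
have [q0'|q0'] := eqVneq (q - N * v i x) 0; last first.
  by rewrite uu ui; field.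
rewrite q0' mulr0 subr0.
have : u i ^+ 2 <= 0.
  rewrite -(mulr0 2) -q0' -uu (bigD1 i)//= lerDl.
  by apply: sumr_ge0 => j _; exact: sqr_ge0.
by rewrite le_eqVlt ltNge sqr_ge0 orbF sqrf_eq0 ui subr_eq0 => /eqP.
Qed.

Lemma ellipsoid_le m (v : 'I_m -> V -> R) i x : ellipsoid v -> `|v i x| <= p x.
Proof.
move=> [_ /(_ x) vp]; rewrite -(@ler_pXn2r _ 2) ?nnegrE ?(seminorm_ge0 _ ps)//.
rewrite real_normK ?num_real//; apply: le_trans vp; rewrite (bigD1 i)//= lerDl.
by apply: sumr_ge0 => j _; exact: sqr_ge0.
Qed.

(* An ellipsoid of almost maximal volume: were one of its high-dimensional tails
   small, stretching the tail and shrinking the rest would enlarge the volume. *)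
Theorem dvoretzky_rogers n : infinite_rank p ->
  exists h : 'I_n -> V -> R,
    [/\ forall j, scalar (h j), forall x, \sum_j h j x ^+ 2 <= p x ^+ 2 &
        forall j, exists2 x, p x <= 1 & 4^-1 <= `|h j x|].
Proof.
move=> pinf; have [h [e [hd e1 he1 he0]]] := triangular_system ps pinf.
pose m := (n + n)%N; pose vol (v : 'I_m -> V -> R) := `|\det (evaluation_mx v e)|.
pose E := [set vol v | v in [set v | ellipsoid v]].
have Eub : has_ubound E.
  exists (\sum_(s : {perm 'I_m}) 1) => _ [v vE <-].
  apply: le_trans (ler_norm_sum _ _ _) _.
  apply: ler_sum => s _; rewrite normrM normrX normrN1 expr1n mul1r normr_prod.
  apply: prodr_ile1 => i _; rewrite normr_ge0 mxE /=.
  by apply: le_trans (ellipsoid_le _ _ vE) _.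
pose v0 (i : 'I_m) x : R := m.+1%:R^-1 * h i x.
have v0E : ellipsoid v0.
  split=> [i a x y|x]; first by rewrite /v0 (hd i).1; ring.
  apply: le_trans (_ : \sum_(i < m) m.+1%:R^-1 * p x ^+ 2 <= _).
    apply: ler_sum => i _; rewrite exprMn; apply: ler_pM; rewrite ?sqr_ge0//.
      by rewrite expr2 ler_piMl ?invr_ge0 ?ler0n ?invf_le1 ?ler1n ?ltr0n.
    rewrite -real_normK ?num_real// ler_pXn2r ?nnegrE ?(seminorm_ge0 _ ps)//.
    exact: (hd i).2.
  rewrite sumr_const card_ord -[_ *+ m]mulr_natl mulrA ler_piMl ?sqr_ge0//.
  by rewrite ler_pdivrMr// mul1r ler_nat.
have vol0 : 0 < vol v0.
  rewrite normr_gt0 (_ : \det _ = \prod_i (evaluation_mx v0 e) i i).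
    apply/prodf_neq0 => i _; rewrite mxE /v0 he1 mulr1.
    by rewrite invr_eq0 pnatr_eq0.
  apply: det_trig; apply/is_trig_mxP => i j ij; rewrite mxE /v0 he0// mulr0//.
have Esup : has_sup E by split=> //; exists (vol v0), v0.
have volE v : ellipsoid v -> vol v <= sup E by move=> vE; apply: ub_le_sup => //; exists v.
have supE0 : 0 < sup E by apply: lt_le_trans vol0 (volE _ v0E).
(* The coordinates are settled one at a time by reflections, which preserve the ellipsoid condition
   and the volume. The threshold [16^-1] below is the square of [4^-1]. *)
suff : forall i, (i <= n)%N -> exists v : 'I_m -> V -> R,
    [/\ ellipsoid v, sup E / 2 < vol v &
        forall j : 'I_m, (j < i)%N -> exists2 x, p x <= 1 & 4^-1 <= `|v j x|].
  move=> /(_ n (leqnn n))[v [vE _ vn]]; exists (fun j => v (lshift n j)); split=> [j|x|j].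
  - by case: vE.
  - apply: le_trans (vE.2 x); rewrite big_split_ord /= lerDl.
    by apply: sumr_ge0 => j _; exact: sqr_ge0.
  - exact: vn (lshift n j) (ltn_ord j).
elim=> [_|i IH lin].
  have supE2 : 0 < sup E / 2 by rewrite divr_gt0.
  have [_ [v vE <-] hv] := sup_adherent supE2 Esup; exists v; split=> //.
  by lra.
have [v [vE vv vn]] := IH (ltnW lin).
have im : (i < m)%N by rewrite (leq_trans lin)// leq_addr.
pose oi := Ordinal im.
have [[x x1 xi]|small] := pselect
    (exists2 x, p x <= 1 & 16^-1 <= \sum_(j < m | (i <= j)%N) v j x ^+ 2).
  have [u [u0 ui]] := reflect_onto v oi x.
  exists (transform (reflection u) v); split=> [||j].
  - split; first by apply: transform_scalar; case: vE.
    by move=> z; rewrite reflection_isometry; case: vE.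
  - by rewrite /vol evaluation_mx_transform det_mulmx normrM det_reflection mul1r.
  - rewrite ltnS leq_eqVlt => /predU1P[ji|ji].
      have -> : j = oi by exact: val_inj.
      exists x => //; rewrite -(@ler_pXn2r _ 2) ?nnegrE ?invr_ge0// real_normK ?num_real// ui.
      by apply: le_trans xi; rewrite exprVn -natrX.
    have [z z1 zj] := vn j ji; exists z => //.
    by rewrite reflection_transform u0// mulr0 mul0r subr0.
exfalso.
have {}small x : \sum_(j < m | (i <= j)%N) v j x ^+ 2 <= 16^-1 * p x ^+ 2.
  have [px|px] := eqVneq (p x) 0.
    rewrite px expr0n /= mulr0.
    have := vE.2 x; rewrite px expr0n /=; apply: le_trans.
    by rewrite big_mkcond; apply: ler_sum => j _; case: ifP => // _; exact: sqr_ge0.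
  have px0 : 0 < p x by rewrite lt_neqAle eq_sym px seminorm_ge0.
  rewrite leNgt; apply/negP => hx; apply: small; exists ((p x)^-1 *: x).
    by rewrite ps.2 gtr0_norm ?invr_gt0// mulVf.
  under eq_bigr do rewrite (scalarfZ (vE.1 _)) exprMn.
  by rewrite -mulr_sumr exprVn ler_pdivlMl ?exprn_gt0// mulrC ltW.
(* Quartering the squares of the head and multiplying those of the tail by 4 leaves a total of at
   most [1/4 + 4/16] times [p x ^+ 2]. *)
pose d (j : 'I_m) : R := if (j < i)%N then 2^-1 else 2.
pose D : 'M[R]_m := diag_mx (\row_j d j).
have DE j x : transform D v j x = d j * v j x.
  rewrite /transform (bigD1 j)//= !mxE eqxx big1 ?addr0// => k kj.
  by rewrite !mxE eq_sym (negbTE kj) mul0r.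
have DvE : ellipsoid (transform D v).
  split; first by apply: transform_scalar; case: vE.
  move=> x; under eq_bigr do rewrite DE.
  have := small x; have := vE.2 x.
  pose tail (j : 'I_m) := (i <= j)%N.
  rewrite (bigID tail) [\sum_j (_ * _) ^+ 2](bigID tail) /= /tail.
  have -> : \sum_(j < m | (i <= j)%N) (d j * v j x) ^+ 2 =
      4 * \sum_(j < m | (i <= j)%N) v j x ^+ 2.
    rewrite mulr_sumr; apply: eq_bigr => j ij; rewrite /d ltnNge ij /= exprMn -natrX//.
  have -> : \sum_(j < m | ~~ (i <= j)%N) (d j * v j x) ^+ 2 =
      4^-1 * \sum_(j < m | ~~ (i <= j)%N) v j x ^+ 2.
    rewrite mulr_sumr; apply: eq_bigr => j; rewrite -ltnNge /d => ->.
    by rewrite exprMn exprVn -natrX.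
  have : 0 <= \sum_(j < m | (i <= j)%N) v j x ^+ 2 by apply: sumr_ge0 => j _; exact: sqr_ge0.
  by have := sqr_ge0 (p x); lra.
have := volE _ DvE; rewrite /vol evaluation_mx_transform det_mulmx normrM -/(vol v).
apply/negP; rewrite -ltNge.
suff : 2 <= `|\det D|.
  move=> D2; apply: lt_le_trans (_ : 2 * vol v <= _); first by lra.
  by apply: ler_wpM2r D2; exact: normr_ge0.
rewrite det_diag; apply: le_trans (ler_norm _).
under eq_bigr do rewrite mxE.
have dr (j : 'I_n) : d (rshift n j) = 2.
  by rewrite /d /= ltnNge (leq_trans (ltnW lin)) ?leq_addr.
have dl : d (lshift n (Ordinal lin)) = 2 by rewrite /d /= ltnn.
(* Coordinate [j] is paired with coordinate [n + j]: every pair contributes at least 1, and the pair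
   of [i] contributes 4. *)
rewrite big_split_ord /= -big_split (bigD1 (Ordinal lin)) //=.
under eq_bigr do rewrite dr.
rewrite dl dr -[leLHS]mulr1; apply: ler_pM => //; first by rewrite -natrM ler_nat.
elim/big_ind : _ => // [a b a1 b1|j _]; first exact: mulr_ege1.
by rewrite /d; case: ifP => _; lra.
Qed.

End DvoretzkyRogers.

(** * Gliding humps in Frechet spaces *)

Section AbsolutelyConvex.
Variables (K : numFieldType) (Y : lmodType K).
Implicit Types (V : set Y) (a b c : K) (x y : Y).

(** Over complex scalars this is weaker than absolute convexity: opposites replace all scalars of
    modulus 1. *)
Definition symmetric_convex V : Prop :=
  [/\ V 0, forall x, V x -> V (- x) &
      forall t x y, 0 <= t -> t <= 1 -> V x -> V y -> V (t *: x + (1 - t) *: y)].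

Definition dilate V c : set Y := [set c *: x | x in V].

Variable V : set Y.
Hypothesis Vsc : symmetric_convex V.

Lemma dilate1 x : dilate V 1 x <-> V x.
Proof. by split=> [[y Vy <-]|Vx]; [rewrite scale1r|exists x; rewrite ?scale1r]. Qed.

Lemma dilate_0 c : dilate V c 0.
Proof. by case: Vsc => V0 _ _; exists 0; rewrite ?scaler0. Qed.

Lemma dilateN c x : dilate V c x -> dilate V c (- x).
Proof. by case: Vsc => _ VN _ [y Vy <-]; exists (- y); [exact: VN|rewrite scalerN]. Qed.

Lemma dilateD a b x y : 0 <= a -> 0 <= b -> dilate V a x -> dilate V b y ->
  dilate V (a + b) (x + y).
Proof.
move=> a0 b0 [x' Vx <-] [y' Vy <-]; case: Vsc => V0 _ VC.
have [/eqP|ab] := eqVneq (a + b) 0.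
  rewrite paddr_eq0// => /andP[/eqP -> /eqP ->]; exists 0 => //.
  by rewrite scaler0 !scale0r addr0.
exists (a / (a + b) *: x' + (1 - a / (a + b)) *: y').
  apply: VC => //; first by rewrite divr_ge0// addr_ge0.
  by rewrite ler_pdivrMr ?mul1r ?lerDl// lt_neqAle eq_sym ab addr_ge0.
have -> : 1 - a / (a + b) = b / (a + b) by field.
have eq1 : (a + b) * (a / (a + b)) = a by field.
have eq2 : (a + b) * (b / (a + b)) = b by field.
by rewrite scalerDr !scalerA eq1 eq2.
Qed.

Lemma dilateZ a b x : dilate V a x -> dilate V (b * a) (b *: x).
Proof. by move=> [y Vy <-]; exists y; rewrite ?scalerA. Qed.

Lemma dilateW a b x : 0 <= a -> a <= b -> dilate V a x -> dilate V b x.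
Proof.
move=> a0 ab ax; rewrite -[x]addr0 -[b](subrK a) addrC.
by apply: dilateD => //; [rewrite subr_ge0|exact: dilate_0].
Qed.

Lemma dilateZV a b x : b != 0 -> dilate V (b * a) (b *: x) -> dilate V a x.
Proof.
move=> b0 /(dilateZ b^-1); rewrite mulrA mulVf// mul1r scalerA mulVf//.
by rewrite scale1r.
Qed.

End AbsolutelyConvex.

(** Size of the vector found in [avoid_planks]: one vector avoiding [s'] planks widened by the
    factor [2 * s' + 3], plus at most [s'.+1] steps of length [2 * c + 1]. *)
Fixpoint plank_factor (s c : nat) : nat :=
  if s is s'.+1 then plank_factor s' (c * (2 * s' + 3)) + (2 * c + 1) * s'.+1 else 0.

Section Planks.
Variables (K : numFieldType) (Z Y : lmodType K) (U : set Z) (V : set Y).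
Hypotheses (Usc : symmetric_convex U) (Vsc : symmetric_convex V).
Variable T : nat -> {linear Z -> Y}.

(* Each member of [l] excludes at most one of [size l + 1] well-spaced points on
   the line through [w + x] with direction [z]. *)
Lemma avoid_planks s c w (l : seq nat) : (size l <= s)%N ->
  (forall i, i \in l -> exists2 z, U z & ~ V (T i z)) ->
  exists2 x, dilate U (plank_factor s c)%:R x &
    forall i, i \in l -> ~ dilate V c%:R (T i (w + x)).
Proof.
elim: s c l => [|s IH] c [|i0 l] // sl hl.
- by exists 0 => //; exact: dilate_0.
- by exists 0 => //; exact: dilate_0.
have [||x Ux xl] := IH (c * (2 * s + 3))%N l; first exact: sl.
  by move=> i il; apply: hl; rewrite inE il orbT.
have [z Uz zi0] := hl i0 (mem_head _ _).
(* A spacing above [2 * c] prevents two of the points from lying in the plank of [i0]. *)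
pose a := (2 * c + 1)%N.
have [k kP] : exists k : 'I_s.+2, forall i, i \in i0 :: l ->
    ~ dilate V c%:R (T i (w + x + (a * k)%:R *: z)).
  apply: contrapT => nk.
  have /choice[f fP] : forall k : 'I_s.+2, exists j : 'I_s.+1,
      (j < size (i0 :: l))%N /\
      dilate V c%:R (T (nth 0%N (i0 :: l) j) (w + x + (a * k)%:R *: z)).
    move=> k; apply: contrapT => nj; apply: nk; exists k => i il hi; apply: nj.
    have jl : (index i (i0 :: l) < size (i0 :: l))%N by rewrite index_mem.
    by exists (Ordinal (leq_trans jl sl)); rewrite /= nth_index.
  have [k1 [k2 [k12 fk]]] : exists k1 k2 : 'I_s.+2, (k1 < k2)%N /\ f k1 = f k2.
    have /injectivePn[k1 [k2 k12 fk]] : ~~ injectiveb f.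
      apply/negP => /injectiveP /leq_card; rewrite !card_ord ltnn//.
    have [h|h|/val_inj h] := ltngtP k1 k2; last by rewrite h eqxx in k12.
      by exists k1, k2.
    by exists k2, k1.
  have [j1 hk1] := fP k1; have [_] := fP k2; rewrite -fk; set i := nth _ _ _ in hk1 * => hk2.
  have il : i \in i0 :: l by exact: mem_nth.
  have d0 : (0 < k2 - k1)%N by rewrite subn_gt0.
  have zi : dilate V (2 * c)%:R ((a * (k2 - k1))%:R *: T i z).
    have := dilateD Vsc (ler0n _ _) (ler0n _ _) hk2 (dilateN Vsc hk1).
    rewrite -natrD addnn -mul2n -linearB /= opprD addrACA subrr add0r -scalerBl.
    by rewrite -natrB ?leq_mul2l ?(ltnW k12) ?orbT// -mulnBr linearZ.
  have ad0 : (0 < a * (k2 - k1))%N by rewrite muln_gt0 d0 /a addn1.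
  move: il; rewrite inE => /predU1P[ii0|il].
    apply: zi0; rewrite -ii0; apply/(dilate1 V).
    apply: (@dilateZV _ _ V _ (a * (k2 - k1))%:R); first by rewrite pnatr_eq0 -lt0n.
    by rewrite mulr1; apply: dilateW zi; rewrite ?ler0n// ler_nat; nia.
  (* Moving back from the point of index [k1] costs at most [2 * c * s.+1], so [w + x] would lie in
     the widened plank that it avoids by induction. *)
  apply: (xl i il).
  have -> : w + x = (w + x + (a * k1)%:R *: z) - (a * k1)%:R *: z by rewrite addrK.
  rewrite linearB /= [T i (_ *: z)]linearZ /=.
  have -> : (c * (2 * s + 3))%:R = c%:R + (2 * c * s.+1)%:R :> K.
    by rewrite -natrD; congr _%:R; lia.
  apply: dilateD => //; apply: dilateN => //.
  pose q : K := (a * k1)%:R / (a * (k2 - k1))%:R.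
  have aq : q * (a * (k2 - k1))%:R = (a * k1)%:R.
    by rewrite /q divfK// pnatr_eq0 -lt0n.
  have := dilateZ q zi; rewrite scalerA aq.
  apply: dilateW => //; first by rewrite mulr_ge0// divr_ge0.
  rewrite /q mulrAC ler_pdivrMr ?ltr0n// -!natrM ler_nat.
  by have := ltn_ord k1; nia.
exists (x + (a * k)%:R *: z); last by move=> i /kP; rewrite addrA.
rewrite /= natrD; apply: dilateD => //.
apply: (@dilateW _ _ U Usc (a * k)%:R) => //.
  by rewrite ler_nat leq_mul2l -ltnS ltn_ord orbT.
by have := dilateZ (a * k)%:R ((dilate1 U z).2 Uz); rewrite mulr1.
Qed.

End Planks.

Section TvsNeighbourhoods.
Variables (K : numFieldType) (Y : tvsType K).

Lemma nbhs0_symmetric_convex (V : set Y) : nbhs 0 V ->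
  exists2 W, nbhs 0 W & symmetric_convex W /\ W `<=` V.
Proof.
move=> V0; have [B Bconv [Bopen Bbase]] := @locally_convex K Y.
have [b [Bb b0] bV] := Bbase 0 V V0.
have nb : nbhs 0 b by apply: open_nbhs_nbhs; split=> //; exact: Bopen.
exists (b `&` (-%R @` b)); first by apply: filterI => //; exact: nbhs0N.
have bC t x y : 0 <= t -> t <= 1 -> b x -> b y -> b (t *: x + (1 - t) *: y).
  move=> t0 t1 bx by_.
  have := Bconv b (mem_set Bb) x y (Itv01 t0 t1) (mem_set bx) (mem_set by_).
  by move/set_mem.
split; last by move=> x [/bV].
split=> [|x [bx [x' bx' xE]]|t x y t0 t1 [bx [x' bx' xE]] [by_ [y' by' yE]]].
- by split=> //; exists 0; rewrite ?oppr0.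
- by split; [rewrite -xE opprK|exists x].
- split; first exact: bC.
  exists (t *: x' + (1 - t) *: y'); first exact: bC.
  by rewrite opprD -!scalerN xE yE.
Qed.

Lemma nbhs0D (V : set Y) : nbhs 0 V ->
  exists2 W : set Y, nbhs 0 W & forall x y, W x -> W y -> V (x + y).
Proof.
move=> V0; have := @add_continuous Y (0, 0) V; rewrite /= addr0 => /(_ V0).
move=> [[A B] [/= A0 B0] AB]; exists (A `&` B); first exact: filterI.
by move=> x y [Ax _] [_ By]; exact: (AB (x, y)).
Qed.

Lemma nbhs0_scale (V : set Y) (c : K) : nbhs 0 V -> nbhs 0 [set x | V (c *: x)].
Proof.
have [->|c0] := eqVneq c 0.
  move=> V0; apply: filterS filterT => x _ /=; rewrite scale0r.
  exact: nbhs_singleton.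
move=> V0; have ci : c^-1 != 0 by rewrite invr_eq0.
by apply: filterS (nbhs0Z ci V0) => _ [y Vy <-] /=; rewrite scalerA divff// scale1r.
Qed.

End TvsNeighbourhoods.

(** * Condensing a failure of boundedness into a function on the indices *)

Section SmallClasses.
Variables (K : numFieldType).
Hypothesis K_archi : forall r : K, 0 < r -> exists n : nat, n.+1%:R^-1 < r.
Variables (F : set_system nat) (F_filter : ProperFilter F) (F_free : free_filter F).
Variables (Z Y : tvsType K) (Z_frechet : frechet_space Z).
Variables (T : nat -> {linear Z -> Y}) (T_cont : forall i, continuous (T i)).
Hypothesis T_bounded : pointwise_filter_bounded F T.

Lemma finite_set_small (s : seq nat) : F (~` [set` s]).
Proof. by apply: F_free; rewrite /frechet_filter /= setCK; exact: finite_seq. Qed.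

(** The factor [mu k.+1] allows a hump from a large multiple of [U k.+1], together with all later
    ones, to stay in [U k]. *)
Lemma metrizable_base (mu : nat -> nat) :
  exists U : nat -> set Z,
    [/\ forall k, nbhs 0 (U k), forall k, symmetric_convex (U k),
        forall W, nbhs 0 W -> exists N, forall k, (N <= k)%N -> U k `<=` W &
        forall k y z, U k.+1 y -> U k.+1 z -> U k ((mu k.+1)%:R *: (y + z))].
Proof.
have [[d [d0 _ _ _] dtop] _] := Z_frechet.
pose ball0 k := [set y | d 0 y < k.+1%:R^-1].
have ball0_nbhs k : nbhs 0 (ball0 k).
  by apply/dtop; exists k.+1%:R^-1; rewrite ?invr_gt0.
have /choice[g gP] : forall kA : nat * set Z, exists B, nbhs 0 kA.2 ->
    [/\ nbhs 0 B, symmetric_convex B, B `<=` ball0 kA.1 &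
        forall y z, B y -> B z -> kA.2 ((mu kA.1)%:R *: (y + z))].
  move=> [k A] /=; have [A0|nA] := pselect (nbhs 0 A); last by exists set0.
  have [W W0 WA] := nbhs0D (nbhs0_scale (mu k)%:R A0).
  have [B B0 [Bsc BW]] := nbhs0_symmetric_convex (filterI W0 (ball0_nbhs k)).
  exists B => _; split=> // [x /BW[]//|y z By Bz].
  by apply: WA; [case: (BW _ By)|case: (BW _ Bz)].
pose U := fix U k := if k is k'.+1 then g (k, U k') else g (0%N, setT).
have U0 k : nbhs 0 (U k).
  by elim: k => [|k IH] /=; [case: (gP (0%N, setT) filterT)|case: (gP (k.+1, U k) IH)].
exists U; split=> // [k|W|k y z].
- by case: k => [|k] /=; [case: (gP (0%N, setT) filterT)|case: (gP (k.+1, U k) (U0 k))].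
- move=> /dtop[r /K_archi[N Nr] rW]; exists N => k Nk x Ukx; apply: rW => /=.
  have : ball0 k x.
    move: Ukx; case: k {Nk} => [|k] /=.
      by case: (gP (0%N, setT) filterT) => _ _ + _; apply.
    by case: (gP (k.+1, U k) (U0 k)) => _ _ + _; apply.
  move=> /lt_trans; apply; apply: le_lt_trans Nr.
  by rewrite lef_pV2 ?posrE// ler_nat ltnS.
- by case: (gP (k.+1, U k) (U0 k)) => _ _ _ /= h Uy Uz; exact: h.
Qed.

(** [kappa i] is the first [m] for which [T i] maps [U m] into [V']. In class [k.+1] each [T i]
    sends some vector of [U k] outside [V'], so by [avoid_planks] a single hump makes all the
    partial sums [T i (S k.+1)] with [i] in [L k.+1] leave [k] times [V']. Boundedness at the sum of
    the humps then forces the selected indices to be null. *)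
Lemma small_classes (V : set Y) (s : nat -> nat) : nbhs 0 V ->
  exists kappa : nat -> nat,
    (forall m, exists2 U : set Z, nbhs 0 U &
       forall i, (kappa i <= m)%N -> T i @` U `<=` V) /\
    forall L : nat -> seq nat, (forall k, (size (L k) <= s k)%N) ->
      F (~` [set i | i \in L (kappa i)]).
Proof.
move=> /nbhs0_symmetric_convex[V' V'0 [V'sc V'V]].
pose mu k := (plank_factor (s k.+1) k).+1.
have [U [U0 Usc Ubase Umu]] := metrizable_base mu.
have mu1 k : 1 <= (mu k)%:R :> K by rewrite ler1n.
have Udil k x : U k x -> dilate (U k) (mu k)%:R x.
  by move=> /dilate1; apply: dilateW.
have UD k x y : dilate (U k.+1) (mu k.+1)%:R x -> dilate (U k.+1) (mu k.+1)%:R y -> U k (x + y).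
  by move=> [x' Ux <-] [y' Uy <-]; rewrite -scalerDr; exact: Umu.
have US k : U k.+1 `<=` U k.
  by move=> x Ux; rewrite -[x]addr0; apply: UD; apply: Udil => //; case: (Usc k.+1).
have Umono k m : (k <= m)%N -> U m `<=` U k.
  move=> /subnK <-; elim: (m - k)%N => [//|n IH]; exact: subset_trans (US _) IH.
have kex i : exists m, `[< T i @` U m `<=` V' >].
  have TV : nbhs 0 (T i @^-1` V').
    by have := @T_cont i 0; rewrite /continuous_at linear0 => /(_ V' V'0).
  have [N UN] := Ubase _ TV; exists N; apply/asboolP => _ [x Ux <-].
  exact: (UN N (leqnn N)).
pose kappa i := ex_minn (kex i).
have kappaU i m : (kappa i <= m)%N -> T i @` U m `<=` V'.
  rewrite /kappa; case: ex_minnP => k /asboolP kU _ km _ [x Ux <-]; apply: kU.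
  by exists x => //; exact: (Umono k m).
have kappaS i k : kappa i = k.+1 -> exists2 z, U k z & ~ V' (T i z).
  rewrite /kappa; case: ex_minnP => n _ nmin nk.
  apply: contrapT => h; have := nmin k; rewrite nk ltnn => hn.
  suff : false by []; apply: hn; apply/asboolP => _ [x Ux <-].
  by apply: contrapT => nV; apply: h; exists x.
exists kappa; split.
  by move=> m; exists (U m) => // i im; apply: subset_trans V'V; exact: kappaU.
(* Odd and even classes are treated separately, so that the hump after a used one is 0: as a large
   multiple of an element of [U k.+1], it could cancel the effect of its predecessor. *)
suff main (L : nat -> seq nat) : (forall k, (size (L k) <= s k)%N) ->
    (forall k, L k = [::] \/ L k.+1 = [::]) -> F (~` [set i | i \in L (kappa i)]).
  move=> L Ls.
  have par b : F (~` [set i | i \in (if odd (kappa i) == b then L (kappa i) else [::])]).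
    apply: (main (fun k => if odd k == b then L k else [::])) => k; first by case: ifP.
    by rewrite /=; case: (odd k); case: b; [right|left|left|right].
  apply: filterS (filterI (par true) (par false)) => i /= [h1 h2] iL.
  by move: h1 h2; case: (odd _) => /=; tauto.
move=> Ls Lalt.
have /choice[X XP] : forall kw : nat * Z, exists x,
    [/\ dilate (U kw.1) (mu kw.1)%:R x, L kw.1.+1 = [::] -> x = 0 &
        forall i, i \in L kw.1.+1 -> kappa i = kw.1.+1 ->
          ~ dilate V' kw.1%:R (T i (kw.2 + x))].
  move=> [k w] /=; have [LN|LN] := pselect (L k.+1 = [::]).
    by exists 0; split=> //; [exact: dilate_0|rewrite LN].
  have [||x Ux xL] := @avoid_planks K Z Y (U k) V' (Usc k) V'sc T (s k.+1) k w
      [seq i <- L k.+1 | kappa i == k.+1].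
  - by apply: leq_trans (Ls k.+1); rewrite size_filter count_size.
  - by move=> i; rewrite mem_filter => /andP[/eqP ik _]; exact: kappaS.
  - exists x; split=> // [|i iL ik].
      by apply: dilateW Ux => //; rewrite ler_nat.
    by apply: xL; rewrite mem_filter ik eqxx.
pose S := fix S k := if k is k'.+1 then S k' + X (k', S k') else 0.
have Stail n k : U k (S (n + k.+1)%N - S k.+1).
  elim: n k => [|n IH] k; first by rewrite add0n subrr; case: (Usc k).
  have -> : S (n.+1 + k.+1)%N - S k.+1 = X (k.+1, S k.+1) + (S (n + k.+2)%N - S k.+2).
    rewrite addSnnS; have gen (a b x : Z) : a - b = x + (a - (b + x)).
      by rewrite [RHS]addrC opprD addrA subrK.
    exact: gen.
  by apply: UD; [case: (XP (k.+1, S k.+1))|apply: Udil; exact: IH].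
have Stail' k m : (k < m)%N -> U k (S m - S k.+1).
  by move=> km; have := Stail (m - k.+1)%N k; rewrite subnK.
have S_cauchy : additive_cauchy (S n @[n --> \oo]).
  move=> W /Ubase[N UN]; exists [set S m | m in [set m | (N.+1 < m)%N]].
    by exists N.+2 => // m /= Nm; exists m.
  move=> _ _ [m Nm <-] [m' Nm' <-]; apply: (UN N) => //.
  have -> : S m - S m' = (S m - S N.+2) + (- (S m' - S N.+2)).
    by rewrite opprB addrA subrK.
  apply: UD; apply: Udil; first exact: Stail'.
  by case: (Usc N.+1) => _ UN' _; apply: UN'; exact: Stail'.
have [x Sx] := Z_frechet.2 _ _ S_cauchy.
(* The limit is only approached by the partial sums, which costs a second summand from [U k]. *)
have xS k : exists2 y, U k y & U k (x - S k.+1 - y).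
  have /(nbhsB (- x)) : nbhs 0 (U k) by exact: U0.
  have Wx : nbhs x [set y | U k (x - y)].
    apply: filterS (nbhsT x (nbhs0N (U0 k))) => _ [_ [y Uy <-] <-] /=.
    by rewrite opprD opprK addrA subrr add0r.
  have [N _ NW] := Sx _ Wx.
  move=> _; exists (S (N + k.+1)%N - S k.+1); first exact: Stail.
  have := NW (N + k.+1)%N (leq_addr _ _).
  by rewrite /= opprB addrA subrK.
have [t t0 tF] := T_bounded x V'0.
have [c cP] : exists c : nat, t^-1 <= c%:R.
  have [n nt] := K_archi t0; exists n.+1.
  by rewrite -[leRHS]invrK lef_pV2 ?posrE ?invr_gt0// ltW.
(* The lists [L k] with [k <= c.+2] cover finitely many indices, a null set since [F] is free. *)
pose early := flatten [seq L k | k <- iota 0 c.+3].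
apply: filterS (filterI tF (finite_set_small early)) => i [/= Vi nL] iL.
have Tx : dilate V' c%:R (T i x).
  apply: (@dilateW _ _ V' V'sc t^-1) => //; first by rewrite invr_ge0 ltW.
  by exists (t *: T i x); rewrite ?scalerA ?mulVf ?scale1r// gt_eqF.
have kc : (c.+2 < kappa i)%N.
  rewrite ltnNge; apply/negP => kc; apply: nL; apply/flattenP.
  by exists (L (kappa i)) => //; apply: map_f; rewrite mem_iota add0n ltnS.
case kE : (kappa i) kc iL => [//|k] kc iL.
have [_ _ /(_ i iL kE)] := XP (k, S k); apply => /=.
rewrite -[_ + _]/(S k.+1).
have S2 : S k.+2 = S k.+1.
  have [LN|LN] := Lalt k.+1; first by rewrite LN in iL.
  by rewrite /=; have [_ /(_ LN) /= -> _] := XP (k.+1, S k.+1); rewrite addr0.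
have [y Uy Uy'] := xS k.+1.
have TU z : U k.+1 z -> dilate V' 1 (T i z).
  by move=> Uz; apply/dilate1; apply: (kappaU i k.+1); [rewrite kE|exists z].
(* Both parts of the tail are mapped into [V'], so [T i x] in [c] times [V'] puts [T i (S k.+1)] in
   [c + 2] times [V'], although [c + 2 <= k]. *)
have -> : S k.+1 = x - (y + (x - S k.+2 - y)).
  by rewrite addrCA subrr addr0 opprB addrC subrK S2.
rewrite linearB linearD; apply: (@dilateW _ _ V' V'sc (c%:R + (1 + 1))).
- by rewrite addr_ge0.
- by rewrite -[1 + 1]/(2%:R) -natrD ler_nat addn2 -ltnS.
- apply: dilateD => //; apply: dilateN => //; apply: dilateD => //; exact: TU.
Qed.

End SmallClasses.

(** * Real and complex scalars *)

(* [j] is [0] in the real case and the imaginary unit in the complex case. *)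
Definition real_structure (R : realType) (K : numFieldType)
    (inj : {rmorphism R -> K}) (j : K) : Prop :=
  [/\ {mono inj : a b / a <= b}, forall z : K, 0 <= z -> exists a, z = inj a,
      `|j| <= 1 &
      forall (X : lmodType K) (phi : X -> R),
        (forall a x y, phi (inj a *: x + y) = a * phi x + phi y) ->
        exists2 h : X -> K, scalar h &
          forall x, inj `|phi x| <= `|h x| <= inj (`|phi x| + `|phi (j *: x)|)].

(** In the complex case [h x] is [phi x - i phi (i x)], with real part [phi x] and modulus at most
    the sum of the absolute values of its two parts. *)
Lemma real_structure_exists (R : realType) (K : numFieldType) :
  K = R :> numFieldType \/ K = R[i] :> numFieldType ->
  exists (inj : {rmorphism R -> K}) (j : K), real_structure inj j.
Proof.
move=> [|] ->.
  exists idfun, 0; split=> // [z _||X phi phil]; first by exists z.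
    by rewrite normr0.
  exists phi => [a x y|x]; first exact: phil.
  by apply/andP; split=> /=; rewrite ?lerDl.
exists (real_complex R), 'i%C; split=> [a b|z||X phi phil].
- by rewrite lecR.
- by rewrite lecE /= => /andP[/eqP zi _]; exists (complex.Re z); case: z zi => a b /= ->.
- by rewrite normc_def /= expr0n /= expr1n add0r sqrtr1.
- have ii (x : X) : 'i%C *: ('i%C *: x) = - x.
    by rewrite scalerA (_ : 'i%C * 'i%C = -1 :> R[i]) ?scaleN1r//; simpc.
  have phi0 : phi 0 = 0 by have := phil 1 0 0; rewrite scaler0 addr0; lra.
  have phiZ a x : phi (real_complex R a *: x) = a * phi x.
    by have := phil a x 0; rewrite addr0 phi0 addr0.
  have phiD x y : phi (x + y) = phi x + phi y.
    by have := phil 1 x y; rewrite rmorph1 scale1r mul1r.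
  have phiN x : phi (- x) = - phi x.
    by have := phiD x (- x); rewrite subrr phi0; lra.
  have phiC (a b : R) x : phi ((a +i* b)%C *: x) = a * phi x + b * phi ('i%C *: x).
    rewrite [X in phi (X *: _)]complexE /= scalerDl phiD phiZ ['i%C * _]mulrC -scalerA.
    by rewrite phiZ.
  have phiCi (a b : R) x : phi ('i%C *: ((a +i* b)%C *: x)) = a * phi ('i%C *: x) - b * phi x.
    rewrite scalerA mulrC -scalerA phiC ii phiN; ring.
  exists (fun x => (phi x -i* phi ('i%C *: x))%C) => [[a b] x y|x].
    rewrite phiD scalerDr phiD phiC phiCi; simpc.
    by congr (_ +i* _)%C; ring.
  apply/andP; split; first exact: normc_ge_Re (phi x -i* phi ('i%C *: x))%C.
  rewrite normc_def /= lecR sqrrN.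
  rewrite -(@ler_pXn2r _ 2) ?nnegrE ?sqrtr_ge0 ?addr_ge0//.
  rewrite sqr_sqrtr ?addr_ge0 ?sqr_ge0// -[phi x ^+ 2]real_normK ?num_real//.
  rewrite -[phi ('i%C *: x) ^+ 2]real_normK ?num_real//.
  by rewrite sqrrD lerD2r lerDl mulrn_wge0// mulr_ge0.
Qed.

(** * Restriction to real scalars, and extension of real functionals to [K] *)

Definition restrict_scalars (R K : pzRingType) (inj : {rmorphism R -> K})
  (X : lmodType K) : Type := X.

Section RestrictScalars.
Variables (R K : pzRingType) (inj : {rmorphism R -> K}) (X : lmodType K).
Local Notation XR := (restrict_scalars inj X).

HB.instance Definition _ := GRing.Zmodule.on XR.

Definition restricted_scale (a : R) (x : XR) : XR := inj a *: (x : X).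

Fact restricted_scaleA a b x :
  restricted_scale a (restricted_scale b x) = restricted_scale (a * b) x.
Proof. by rewrite /restricted_scale scalerA rmorphM. Qed.

Fact restricted_scale1 : left_id 1 restricted_scale.
Proof. by move=> x; rewrite /restricted_scale rmorph1 scale1r. Qed.

Fact restricted_scaleDr : right_distributive restricted_scale +%R.
Proof. by move=> a x y; rewrite /restricted_scale scalerDr. Qed.

Fact restricted_scaleDl x : {morph restricted_scale^~ x : a b / a + b}.
Proof. by move=> a b; rewrite /restricted_scale rmorphD scalerDl. Qed.

HB.instance Definition _ := GRing.Zmodule_isLmodule.Build R XR
  restricted_scaleA restricted_scale1 restricted_scaleDr restricted_scaleDl.

End RestrictScalars.

Section Complexification.
Variables (R : realType) (K : numFieldType) (inj : {rmorphism R -> K}) (j : K).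
Hypothesis RK : real_structure inj j.
Variables (X : lmodType K) (P : X -> K).
Hypotheses (P0 : forall x, 0 <= P x) (PZ : forall a x, P (a *: x) = `|a| * P x).
Hypothesis PD : forall x y, P (x + y) <= P x + P y.
Hypothesis Pinf : ~ exists (n : nat) (e : 'I_n -> X),
  forall x, exists c : 'I_n -> K, P (x - \sum_(i < n) c i *: e i) = 0.

Let inj_mono : {mono inj : a b / a <= b}. Proof. by case: RK. Qed.

Let inj_norm a : `|inj a| = inj `|a|.
Proof.
have [a0|a0] := leP 0 a; first by rewrite !ger0_norm -?(rmorph0 inj) ?inj_mono.
by rewrite [in RHS]ltr0_norm// rmorphN ler0_norm// -(rmorph0 inj) inj_mono ltW.
Qed.

(** The values of [P] are real, and real combinations are particular combinations over [K], so the
    rank stays infinite. The last clause keeps [j *: x] in the unit ball. *)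
Lemma real_seminorm : exists p : restrict_scalars inj X -> R,
  [/\ seminorm p, infinite_rank p, forall x, inj (p x) = P x &
      forall x, p (j *: (x : X)) <= p x].
Proof.
have /choice[p pP] : forall x, exists a, P x = inj a by move=> x; case: RK => _ + _ _; apply.
exists p; split=> [|[n [e he]]|//|x].
- split=> [x y|a x]; first by rewrite -inj_mono rmorphD -!pP PD.
  apply: (fmorph_inj inj); rewrite rmorphM -!pP -inj_norm; exact: PZ.
- apply: Pinf; exists n, e => x; have [c hc] := he x; exists (fun i => inj (c i)).
  by rewrite pP [X in inj X]hc rmorph0.
- by rewrite -inj_mono -!pP PZ ler_piMl//; case: RK.
Qed.

Lemma complexify (p : restrict_scalars inj X -> R) (phi : restrict_scalars inj X -> R) C :
  (forall x, inj (p x) = P x) -> (forall x, p (j *: (x : X)) <= p x) -> 0 <= C ->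
  scalar phi -> (forall x, `|phi x| <= C * p x) ->
  exists h : X -> K, [/\ scalar h, exists D : K, forall x, `|h x| <= D * P x &
    forall x, inj `|phi x| <= `|h x| <= inj (`|phi x| + `|phi (j *: (x : X))|)].
Proof.
move=> pP pj C0 phil phip; have [_ _ _ /(_ X phi phil)[h hl hphi]] := RK.
exists h; split=> //; exists (inj (C + C)) => x.
have /andP[_ /le_trans] := hphi x; apply; rewrite -pP -rmorphM inj_mono mulrDl.
by apply: lerD => //; apply: le_trans (phip _) _; rewrite ler_wpM2l.
Qed.

Lemma natr_inj n : inj n%:R = n%:R. Proof. exact: rmorph_nat. Qed.

Lemma scaled_almost_weak_star_null (k : nat) : exists h : nat -> X -> K,
  [/\ forall n, scalar (h n), forall n, exists D : K, forall x, `|h n x| <= D * P x,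
      forall n, exists2 x, P x <= 1 & k%:R <= `|h n x| &
      forall x, P x <= 1 -> exists N, forall n, (N <= n)%N -> `|h n x| <= 1].
Proof.
have [p [ps pinf pP pj]] := real_seminorm.
have p1 x : (P x <= 1) = (p x <= 1) by rewrite -pP -(rmorph1 inj) inj_mono.
(* After scaling by [k.+1], the real values at [x] and at [j *: x] both end up at most 1/2. *)
have e0 : 0 < (2 * k.+1%:R)^-1 :> R by rewrite invr_gt0 mulr_gt0.
have [phi [phil [C phiC] phi1 philim]] := weak_josefson_nissenzweig ps pinf e0.
pose f n x := k.+1%:R * phi n x.
have /choice[h hP] : forall n, exists h : X -> K,
    [/\ scalar h, exists D : K, forall x, `|h x| <= D * P x &
     forall x, inj `|f n x| <= `|h x| <= inj (`|f n x| + `|f n (j *: (x : X))|)].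
  move=> n; apply: (@complexify p (f n) (k.+1%:R * `|C|)) => //.
  - by move=> a x y; rewrite /f phil; ring.
  - move=> x; rewrite normrM normr_nat -mulrA ler_wpM2l//.
    apply: le_trans (phiC _ _) _; rewrite ler_wpM2r ?(seminorm_ge0 _ ps)//.
    exact: ler_norm.
exists h; split=> [n|n|n|x].
- by case: (hP n).
- by case: (hP n).
- have [x x1 phix] := phi1 n; exists x; first by rewrite p1.
  have [_ _ /(_ x)/andP[+ _]] := hP n; apply: le_trans; rewrite -natr_inj inj_mono.
  rewrite normrM normr_nat -[leLHS]mulr1; apply: ler_pM; rewrite ?ler_nat//.
  exact: le_trans phix (ler_norm _).
- rewrite p1 => x1; have [N HN] := philim x x1.
  have [N' HN'] := philim _ (le_trans (pj x) x1).
  exists (maxn N N') => n; rewrite geq_max => /andP[Nn N'n].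
  have [_ _ /(_ x)/andP[_ /le_trans]] := hP n; apply.
  rewrite -(rmorph1 inj) inj_mono !normrM normr_nat -mulrDr.
  have := lerD (HN n Nn) (HN' n N'n); rewrite -(ler_pM2l (ltr0Sn R k)) => /le_trans; apply.
  rewrite invfM mulrDr mulrCA mulfV ?pnatr_eq0// mulr1; lra.
Qed.

(** If squares sum to at most [16 * k.+1 ^ 2], at most [64 * k.+1 ^ 2] of the values exceed 1/2; the
    count doubles because [x] and [j *: x] both contribute. *)
Definition large_bound (k : nat) : nat := 128 * k.+1 ^ 2.

Lemma count_large (T : eqType) (l : seq T) (a : T -> R) (c B : R) :
  (forall i, 0 <= a i) -> \sum_(i <- l) a i <= B ->
  (count (fun i => c < a i) l)%:R * c <= B.
Proof.
move=> a0; apply: le_trans; elim: l => [|i l IH]; first by rewrite big_nil mul0r.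
rewrite big_cons /= natrD mulrDl; apply: lerD => //.
by case: ltP => [/ltW|_]; rewrite ?mul1r ?mul0r.
Qed.

Lemma scaled_dvoretzky_rogers (k : nat) (l : seq nat) : uniq l ->
  exists h : nat -> X -> K,
  [/\ forall n, scalar (h n), forall n, exists D : K, forall x, `|h n x| <= D * P x,
      forall n, n \in l -> exists2 x, P x <= 1 & k%:R <= `|h n x| &
      forall x, P x <= 1 ->
        (size [seq n <- l | ~~ (`|h n x| <= 1)%R] <= large_bound k)%N].
Proof.
move=> lu; have [p [ps pinf pP pj]] := real_seminorm.
have p1 x : (P x <= 1) = (p x <= 1) by rewrite -pP -(rmorph1 inj) inj_mono.
have [phi [phil phi2 phi1]] := dvoretzky_rogers ps (size l) pinf.
have phip i x : `|phi i x| <= p x by apply: (@ellipsoid_le _ _ p ps).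
(* The factor 4 makes up for the [4^-1] of [dvoretzky_rogers]; indices outside [l] get 0. *)
pose f n x := if insub (index n l) is Some i then 4 * k.+1%:R * phi i x else 0.
have fnth (i : 'I_(size l)) x : f (nth 0%N l i) x = 4 * k.+1%:R * phi i x.
  by rewrite /f index_uniq// valK.
have /choice[h hP] : forall n, exists h : X -> K,
    [/\ scalar h, exists D : K, forall x, `|h x| <= D * P x &
     forall x, inj `|f n x| <= `|h x| <= inj (`|f n x| + `|f n (j *: (x : X))|)].
  move=> n; apply: (@complexify p (f n) (4 * k.+1%:R)) => //.
  - by move=> a x y; rewrite /f; case: insub => [i|]; [rewrite phil|]; ring.
  - move=> x; rewrite /f; case: insub => [i|]; last first.
      by rewrite normr0 !mulr_ge0// (seminorm_ge0 _ ps).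
    by rewrite normrM ger0_norm ?mulr_ge0// ler_wpM2l ?mulr_ge0.
have fsum x : p x <= 1 -> \sum_(n <- l) f n x ^+ 2 <= 16 * k.+1%:R ^+ 2.
  move=> x1; rewrite (big_nth 0%N) big_mkord.
  under eq_bigr do rewrite fnth exprMn.
  rewrite -mulr_sumr -[leRHS]mulr1 exprMn -natrX.
  apply: ler_pM => //; rewrite ?mulr_ge0 ?sqr_ge0 ?sumr_ge0//.
  - by move=> i _; exact: sqr_ge0.
  - by rewrite -natrX.
  apply: le_trans (phi2 x) _; rewrite expr2.
  by apply: mulr_ile1; rewrite ?(seminorm_ge0 _ ps).
have fcount x : p x <= 1 ->
    (count (fun n => 2^-1 < `|f n x|)%R l <= 64 * k.+1 ^ 2)%N.
  move=> /fsum/count_large => /(_ 4^-1) H.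
  have := H (fun i => sqr_ge0 _); rewrite ler_pdivrMr// -(ler_nat R) natrM natrX => H'.
  apply: le_trans (_ : (count (fun i => 4^-1 < f i x ^+ 2) l)%:R <= _).
    rewrite ler_nat; apply: sub_count => n /= hn.
    rewrite -[f n x ^+ 2]real_normK ?num_real//.
    have -> : 4^-1 = 2^-1 ^+ 2 :> R by rewrite exprVn -natrX.
    by rewrite ltr_pXn2r ?nnegrE ?invr_ge0.
  by apply: le_trans H' _; lra.
exists h; split=> [n|n|n nl|x].
- by case: (hP n).
- by case: (hP n).
- have nl' : (index n l < size l)%N by rewrite index_mem.
  have [x x1 phix] := phi1 (Ordinal nl'); exists x; first by rewrite p1.
  have [_ _ /(_ x)/andP[+ _]] := hP n; apply: le_trans; rewrite -natr_inj inj_mono.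
  have := fnth (Ordinal nl') x; rewrite /= nth_index// => ->.
  rewrite normrM ger0_norm ?mulr_ge0//.
  apply: le_trans (_ : 4 * k.+1%:R * 4^-1 <= _); last by rewrite ler_wpM2l// mulr_ge0.
  by rewrite mulrAC mulfV ?pnatr_eq0// mul1r ler_nat.
- rewrite p1 => x1; rewrite size_filter.
  have := leq_add (fcount x x1) (fcount _ (le_trans (pj x) x1)).
  rewrite -mulnDl; apply: leq_trans.
  rewrite -count_predUI; apply: leq_trans (leq_addr _ _).
  apply: sub_count => n /=; apply: contraR; rewrite negb_or -!leNgt => /andP[h1 h2].
  have [_ _ /(_ x)/andP[_ /le_trans]] := hP n; apply.
  by rewrite -(rmorph1 inj) inj_mono; lra.
Qed.

End Complexification.

(** * From small classes to unbounded functionals *)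

Section Transfer.
Variables (R : realType) (K : numFieldType) (inj : {rmorphism R -> K}) (j : K).
Hypothesis RK : real_structure inj j.
Variables (X : tvsType K) (P : X -> K).
Hypotheses (P0 : forall x, 0 <= P x) (PZ : forall a x, P (a *: x) = `|a| * P x).
Hypothesis PD : forall x y, P (x + y) <= P x + P y.
Hypothesis Pinf : ~ exists (n : nat) (e : 'I_n -> X),
  forall x, exists c : 'I_n -> K, P (x - \sum_(i < n) c i *: e i) = 0.
Hypothesis P_nbhs : forall r, 0 < r -> nbhs 0 [set x | P x < r].

Lemma real_structure_archi (r : K) : 0 <= r -> exists n : nat, r <= n%:R.
Proof.
move=> r0; have [mono sur _ _] := RK; have [a ->] := sur r r0.
exists (Num.trunc a).+1; rewrite -(rmorph_nat inj) mono.
exact: ltW (truncnS_gt a).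
Qed.

Lemma bounded_functional (h : X -> K) (D : K) : scalar h ->
  (forall x, `|h x| <= D * P x) ->
  exists2 g : {linear X -> K^o}, g =1 h & continuous g.
Proof.
move=> hl hD; pose hlin := GRing.isLinear.Build K X K^o *:%R h hl.
pose g : {linear X -> K^o} := HB.pack (h : X -> K^o) hlin.
exists g => // x; apply/cvgrPdist_lt => e e0.
have D0 : 0 < `|D| + 1 by rewrite ltr_wpDl.
(* [D] is an arbitrary scalar, forced to be nonnegative only where [P] is nonzero. *)
have hP y : `|h y| <= (`|D| + 1) * P y.
  have [Py|Py] := eqVneq (P y) 0; first by have := hD y; rewrite Py !mulr0.
  have Py0 : 0 < P y by rewrite lt_neqAle eq_sym Py P0.
  have Dr : 0 <= D by rewrite -(pmulr_lge0 _ Py0) (le_trans _ (hD y)).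
  by apply: le_trans (hD y) _; rewrite ler_wpM2r// ger0_norm// lerDl.
have := nbhsT x (P_nbhs (divr_gt0 e0 D0)).
apply: filterS => _ [y /= Py <-].
rewrite /= (_ : h (x + y) = h x + h y); last by rewrite -[x in LHS]scale1r hl mul1r.
rewrite opprD addrA subrr sub0r normrN.
by apply: le_lt_trans (hP y) _; rewrite -ltr_pdivlMl// mulrC.
Qed.

Variables (F : set_system nat) (F_filter : ProperFilter F) (F_free : free_filter F).

Lemma filter_boundedW (g : nat -> {linear X -> K^o}) :
  (forall x, P x <= 1 -> F [set i | `|g i x| <= 1]) -> pointwise_filter_bounded F g.
Proof.
move=> g1 x V /nbhs_normP[r /= r0 rV].
have [n nP] := real_structure_archi (P0 x).
have c0 : 0 < n.+1%:R :> K by [].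
exists (r / (2 * n.+1%:R)); first by rewrite divr_gt0// mulr_gt0.
have := g1 (n.+1%:R^-1 *: x).
rewrite PZ gtr0_norm ?invr_gt0// ler_pdivrMl// mulr1.
move=> /(_ (le_trans nP _)) gF.
apply: filterS (gF _); last by rewrite ler_nat.
move=> i /=; rewrite linearZ /= normrM gtr0_norm ?invr_gt0// ler_pdivrMl// mulr1 => gi.
apply: rV => /=; rewrite /ball_ /= sub0r normrN normrM gtr0_norm ?divr_gt0 ?mulr_gt0//.
apply: le_lt_trans (_ : r / 2 < _); last by rewrite ltr_pdivrMr// ltr_pMr// ltr1n.
rewrite invfM mulrA -mulrA ler_piMr ?divr_ge0 ?(ltW r0)//.
by rewrite ler_pdivrMl// mulr1.
Qed.

(* Either every subset of [I] which is finite on each class of [kappa] is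
   [F]-null and pointwise null sequences are used on the classes, or [I] may be
   replaced by such a subset and Dvoretzky-Rogers systems are used instead. *)
Lemma transfer_unbounded (kappa : nat -> nat) (I : set nat) :
  (forall L : nat -> seq nat, (forall k, (size (L k) <= large_bound k)%N) ->
     F (~` [set i | i \in L (kappa i)])) ->
  (forall m, filter_stationary F [set i | I i /\ (m < kappa i)%N]) ->
  exists (J : set nat) (g : nat -> {linear X -> K^o}),
    [/\ J `<=` I, forall m, filter_stationary F [set i | J i /\ (m < kappa i)%N],
        forall i, continuous (g i) /\ exists D, forall x, `|g i x| <= D * P x,
        pointwise_filter_bounded F g &
        forall i, J i -> exists2 x, P x <= 1 & (kappa i)%:R <= `|g i x|].
Proof.
move=> small Iunb.
have [nullI|] := pselect (forall J : set nat, J `<=` I ->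
    (forall k, finite_set [set i | J i /\ kappa i = k]) -> F (~` J)).
  have /choice[h hP] := scaled_almost_weak_star_null RK P0 PZ PD Pinf.
  have /choice[g gP] : forall i, exists g : {linear X -> K^o},
      (continuous g /\ exists D, forall x, `|g x| <= D * P x) /\
      forall x, g x = if `[< I i >] then h (kappa i) i x else 0.
    move=> i; have [hl hb _ _] := hP (kappa i); have [D hD] := hb i.
    have [||g gE gc] := @bounded_functional
        (fun x => if `[< I i >] then h (kappa i) i x else 0) (if `[< I i >] then D else 0).
    - by case: asboolP => _; [exact: hl|move=> a x y; rewrite mulr0 addr0].
    - by move=> x; case: asboolP => _; rewrite ?normr0 ?mul0r.
    - exists g; split=> //; split=> //; exists (if `[< I i >] then D else 0) => x.
      by rewrite gE; case: asboolP => _; rewrite ?normr0 ?mul0r.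
  exists I, g; split=> // [i||i Ii]; first by case: (gP i).
    apply: filter_boundedW => x x1.
    (* The exceptional set at [x] is finite on each class, since each class carries an eventually
       bounded sequence; so it is null. *)
    pose J := [set i | I i /\ ~ (`|h (kappa i) i x| <= 1)].
    have : F (~` J).
      apply: nullI => [i []//|k].
      have [_ _ _ /(_ x x1)[N HN]] := hP k.
      apply: sub_finite_set (finite_seq (iota 0 N)) => i [[_ hi] ik] /=.
      rewrite mem_iota add0n /= ltnNge; apply/negP => Ni; apply: hi.
      by rewrite ik; exact: HN.
    apply: filterS => i nJ /=; rewrite (gP i).2; case: asboolP => [Ii|_].
      by apply: contrapT => hi; apply: nJ.
    by rewrite normr0.
  have [_ _ /(_ i)[x x1 hx] _] := hP (kappa i); exists x => //.
  by rewrite (gP i).2; case: asboolP.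
move=> /existsNP[J /not_implyP[JI /not_implyP[Jfin Jstat]]].
have /choice[L LP] : forall k, exists l : seq nat,
    uniq l /\ forall i, i \in l <-> J i /\ kappa i = k.
  move=> k; have /finite_seqP[s sE] := Jfin k; exists (undup s).
  split=> [|i]; first exact: undup_uniq.
  rewrite mem_undup; split=> [si|Ji].
    by have : [set` s] i by []; rewrite -sE.
  by have : [set i | J i /\ kappa i = k] i by []; rewrite sE.
have /choice[h hP] : forall k, exists h : nat -> X -> K,
    [/\ forall n, scalar (h n), forall n, exists D : K, forall x, `|h n x| <= D * P x,
      forall n, n \in L k -> exists2 x, P x <= 1 & k%:R <= `|h n x| &
      forall x, P x <= 1 ->
        (size [seq n <- L k | ~~ (`|h n x| <= 1)%R] <= large_bound k)%N].
  by move=> k; exact: (scaled_dvoretzky_rogers RK P0 PZ PD Pinf k (LP k).1).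
have /choice[g gP] : forall i, exists g : {linear X -> K^o},
    (continuous g /\ exists D, forall x, `|g x| <= D * P x) /\
    forall x, g x = if `[< J i >] then h (kappa i) i x else 0.
  move=> i; have [hl hb _ _] := hP (kappa i); have [D hD] := hb i.
  have [||g gE gc] := @bounded_functional
      (fun x => if `[< J i >] then h (kappa i) i x else 0) (if `[< J i >] then D else 0).
  - by case: asboolP => _; [exact: hl|move=> a x y; rewrite mulr0 addr0].
  - by move=> x; case: asboolP => _; rewrite ?normr0 ?mul0r.
  - exists g; split=> //; split=> //; exists (if `[< J i >] then D else 0) => x.
    by rewrite gE; case: asboolP => _; rewrite ?normr0 ?mul0r.
exists J, g; split=> // [m|i||i Ji].
- move=> Fm; apply: Jstat.
  (* [J] meets the classes up to [m] in a finite set, so removing them leaves it stationary. *)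
  pose early := flatten [seq L k | k <- iota 0 m.+1].
  apply: filterS (filterI Fm (finite_set_small F_free early)) => i [/= nm ne] Ji.
  apply: nm; split=> //; rewrite ltnNge; apply/negP => im; apply: ne.
  apply/flattenP; exists (L (kappa i)); last by apply/(LP (kappa i)).2.
  by apply: map_f; rewrite mem_iota add0n ltnS.
- by case: (gP i).
- apply: filter_boundedW => x x1.
  have /small : forall k, (size [seq n <- L k | ~~ (`|h k n x| <= 1)%R] <= large_bound k)%N.
    by move=> k; have [_ _ _] := hP k; apply.
  apply: filterS => i /= nL.
  rewrite (gP i).2; case: asboolP => [Ji|_]; last by rewrite normr0.
  apply/negPn/negP => hi; apply: nL; rewrite mem_filter hi /=.
  by apply/(LP (kappa i)).2.
- have iL : i \in L (kappa i) by apply/(LP (kappa i)).2.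
  have [_ _ /(_ i iL)[x x1 hx] _] := hP (kappa i).
  by exists x => //; rewrite (gP i).2; case: asboolP.
Qed.

End Transfer.

(** * The seminorm pulled back from a normed quotient *)

Section QuotientSeminorm.
Variables (K : numFieldType) (X : tvsType K) (N : submodClosed X).
Local Open Scope quotient_scope.
Local Notation Q := (quotient_space N).
Variable q : Q -> K.
Hypotheses (q_norm : is_norm q) (q_top : induces_topology (fun x y : Q => q (x - y))).
Hypothesis Q_inf : infinite_dimensional Q.

Definition quotient_seminorm (x : X) : K := q (\pi_Q x).

Lemma piZ (a : K) (x : X) : \pi_Q (a *: x) = a *: \pi_Q x.
Proof. exact: pi_scale. Qed.

Lemma pi0 : \pi_Q (0 : X) = 0.
Proof. by rewrite -(scale0r (0 : X)) piZ scale0r. Qed.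

Lemma pi_sum n (c : 'I_n -> K) (e : 'I_n -> X) :
  \pi_Q (\sum_(i < n) c i *: e i) = \sum_(i < n) c i *: \pi_Q (e i).
Proof.
elim/big_ind2 : _ => [|x u y v <- <-|i _]; [exact: pi0|exact: piD|exact: piZ].
Qed.

Lemma quotient_norm0 : q 0 = 0.
Proof. by case: q_norm => _ _ qZ _; rewrite -(scale0r 0) qZ normr0 mul0r. Qed.

Lemma quotient_normN u : q (- u) = q u.
Proof. by case: q_norm => _ _ qZ _; rewrite -scaleN1r qZ normrN1 mul1r. Qed.

Lemma quotient_seminorm_infinite : ~ exists (n : nat) (e : 'I_n -> X),
  forall x, exists c : 'I_n -> K,
    quotient_seminorm (x - \sum_(i < n) c i *: e i) = 0.
Proof.
move=> [n [e he]]; apply: Q_inf; exists n, (fun i => \pi_Q (e i)) => u.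
have [c hc] := he (repr u); exists c; case: q_norm => _ q0 _ _.
have := q0 _ hc; rewrite piD -scaleN1r piZ scaleN1r pi_sum reprK.
by move/eqP; rewrite subr_eq0 => /eqP.
Qed.

Lemma quotient_seminorm_nbhs r : 0 < r -> nbhs 0 [set x | quotient_seminorm x < r].
Proof.
move=> r0; have : nbhs (0 : Q) [set u | q (0 - u) < r] by apply/q_top; exists r.
rewrite -pi0 => /(@pi_continuous X (Quotient.quot (submod N))) Hr.
have {}Hr : nbhs (0 : X) [set x | q (\pi_Q (0 : X) - \pi_Q x) < r] := Hr.
apply: filterS Hr => x /=.
by rewrite pi0 sub0r quotient_normN.
Qed.

(** The quotient map is open: the preimage of the image of [O] is the union of the translates of [O]
    by elements of [N]. *)
Lemma quotient_seminorm_open (U : set X) : nbhs 0 U ->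
  exists2 r, 0 < r & forall x, quotient_seminorm x < r ->
    exists2 u, U u & quotient_seminorm (x - u) = 0.
Proof.
rewrite nbhsE => -[O [Oopen O0] OU].
have Qnbhs : nbhs (0 : Q) [set \pi_Q u | u in O].
  apply: open_nbhs_nbhs; split; last by exists 0 => //; exact: pi0.
  rewrite /open /= /quotient_open.
  rewrite (_ : _ @^-1` _ = \bigcup_(n in [set n | n \in N]) (+%R n @` O)).
    apply: bigcup_open => n _; rewrite openE => _ [u Ou <-].
    apply: nbhsB.
    by apply: open_nbhs_nbhs.
  apply/seteqP; split=> x /=.
    move=> [u Ou /esym/pi_quotientP xu]; exists (x - u) => //.
    by exists u; rewrite // subrK.
  move=> [n nN [u Ou <-]]; exists u => //; apply/esym/pi_quotientP.
  by rewrite addrK.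
have /q_top[r r0 rQ] := Qnbhs; exists r => // x xr.
have [|u Ou ux] := rQ (\pi_Q x); first by rewrite /= sub0r quotient_normN.
exists u; first exact: OU.
by rewrite /quotient_seminorm piD -scaleN1r piZ scaleN1r ux subrr quotient_norm0.
Qed.

End QuotientSeminorm.

(** A ball of [P] lies in [U] plus the kernel of [P], on which each [g i] vanishes. So a bound for
    [g i] on [U] bounds it on the unit ball of [P], where it reaches [kappa i]. *)
Lemma unbounded_functionals (R : realType) (K : numFieldType)
    (K_real_or_complex : K = R :> numFieldType \/ K = R[i] :> numFieldType)
    (X : tvsType K) (X_quotient : has_infinite_dimensional_normable_quotient X)
    (F : set_system nat) (F_filter : ProperFilter F) (F_free : free_filter F)
    (kappa : nat -> nat) (I : set nat) :
  (forall L : nat -> seq nat, (forall k, (size (L k) <= large_bound k)%N) ->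
     F (~` [set i | i \in L (kappa i)])) ->
  (forall m, filter_stationary F [set i | I i /\ (m < kappa i)%N]) ->
  exists (J : set nat) (g : nat -> {linear X -> K^o}),
    [/\ J `<=` I, forall m, filter_stationary F [set i | J i /\ (m < kappa i)%N],
        forall i, continuous (g i), pointwise_filter_bounded F g &
        forall U : set X, nbhs 0 U -> exists m, forall i, J i ->
          g i @` U `<=` [set z | `|z| < 1] -> (kappa i <= m)%N].
Proof.
move=> small Iunb; have [inj [j RK]] := real_structure_exists K_real_or_complex.
have [N [Qinf [q q_norm q_top]]] := X_quotient.
pose P := quotient_seminorm q; have [q0 _ qZ qD] := q_norm.
have P0 x : 0 <= P x by exact: q0.
have PZ a x : P (a *: x) = `|a| * P x by rewrite /P /quotient_seminorm piZ.
have PD x y : P (x + y) <= P x + P y by rewrite /P /quotient_seminorm piD.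
have Pinf := quotient_seminorm_infinite q_norm Qinf.
have Pnbhs := quotient_seminorm_nbhs q_norm q_top.
have [J [g [JI Junb gc gb gP]]] :=
  transfer_unbounded RK P0 PZ PD Pinf Pnbhs F_filter F_free small Iunb.
exists J, g; split=> // [i|U U0]; first by case: (gc i).
have [r r0 rU] := quotient_seminorm_open q_norm q_top U0.
have r20 : 0 < r / 2 by rewrite divr_gt0.
have r2i : 0 <= (r / 2)^-1 by rewrite invr_ge0 ltW.
have [m mr] := real_structure_archi RK r2i.
exists m => i Ji gU; rewrite leqNgt; apply/negP => mk.
have [x x1 gx] := gP i Ji.
have [u Uu xu] : exists2 u, U u & P (r / 2 *: x - u) = 0.
  apply: rU; rewrite -/(P _) PZ gtr0_norm//.
  apply: le_lt_trans (_ : r / 2 < r); first by rewrite ler_piMr// ltW.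
  by rewrite ltr_pdivrMr// ltr_pMr// ltr1n.
have gu : g i (r / 2 *: x) = g i u.
  apply/eqP; rewrite -subr_eq0 -linearB -normr_le0.
  have [_ [D gD]] := gc i.
  by rewrite (le_trans (gD _))// xu mulr0.
have : `|g i u| < 1 by apply: gU; exists u.
rewrite -gu linearZ /= normrM gtr0_norm// -ltr_pdivlMl// mulr1.
move=> /lt_le_trans /(_ mr) /(le_lt_trans gx).
by rewrite ltr_nat ltnNge ltnW.
Qed.

(** * The two equivalences, plain and stationary *)

Lemma filter_stationaryS (F : set_system nat) (F_filter : Filter F) (A B : set nat) :
  A `<=` B -> filter_stationary F A -> filter_stationary F B.
Proof. by move=> AB FA FB; apply: FA; apply: filterS FB => i nB /AB. Qed.

Theorem lemma5p4 (R : realType) (K : numFieldType)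
    (K_real_or_complex : K = R :> numFieldType \/ K = R[i] :> numFieldType)
    (X : tvsType K) (X_frechet : frechet_space X)
    (X_quotient : has_infinite_dimensional_normable_quotient X)
    (F : set_system nat) (F_filter : ProperFilter F) (F_free : free_filter F) :
  (uniform_boundedness_principle F X <-> UBP_filter K F) /\
  (stationary_uniform_boundedness_principle F X <-> stationary_UBP_filter K F).
Proof.
have [inj [j RK]] := real_structure_exists K_real_or_complex.
have archi (r : K) : 0 < r -> exists n : nat, n.+1%:R^-1 < r.
  move=> r0; have ri : 0 <= r^-1 by rewrite invr_ge0 ltW.
  have [n rn] := real_structure_archi RK ri; exists n.
  rewrite -[ltRHS]invrK ltf_pV2 ?posrE ?invr_gt0//.
  by apply: le_lt_trans rn _; rewrite ltr_nat.
have ball1 : nbhs (0 : K^o) [set z | `|z| < 1].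
  apply/nbhs_normP; exists 1 => //= z; rewrite /ball_ /= sub0r normrN.
  exact.
split; split=> [XP Z Z_frechet Y T Tc Tb|ubp].
- apply: contrapT => nT.
  have [V V0 nV] : exists2 V : set Y, nbhs 0 V & forall U : set Z, nbhs 0 U ->
      ~ F [set i | T i @` U `<=` V].
    apply: contrapT => h; apply: nT => V V0; apply: contrapT => nU; apply: h.
    by exists V => // U U0 FU; apply: nU; exists U.
  have [kappa [kU small]] :=
    small_classes archi F_filter F_free Z_frechet Tc Tb large_bound V0.
  (* Were the set of [i] with [kappa i <= m] in [F], the neighbourhood given by [kU] would show
     equicontinuity for [V]. *)
  have unb m : filter_stationary F [set i | [set: nat] i /\ (m < kappa i)%N].
    have [U U0 UV] := kU m => Fm; apply: (nV U U0).
    apply: filterS Fm => i /= im; apply: UV; rewrite leqNgt; apply/negP => mi.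
    exact: im.
  have [J [g [_ Junb gc gb gU]]] :=
    unbounded_functionals K_real_or_complex X_quotient F_filter F_free small unb.
  have [U U0 FU] := XP _ g gc gb _ ball1.
  have [m mP] := gU U U0; apply: (Junb m); apply: filterS FU => i gi [Ji].
  by rewrite ltnNge mP.
- exact: ubp.
- apply: contrapT => nT.
  have [I [V [Istat V0 nV]]] : exists (I : set nat) (V : set Y),
      [/\ filter_stationary F I, nbhs 0 V &
        forall (U : set Z) J, nbhs 0 U -> J `<=` I ->
          (forall i, J i -> T i @` U `<=` V) -> ~ filter_stationary F J].
    apply: contrapT => h; apply: nT => I V Istat V0; apply: contrapT => nU; apply: h.
    exists I, V; split=> // U J U0 JI JV Jstat; apply: nU.
    by exists U, J.
  have [kappa [kU small]] :=
    small_classes archi F_filter F_free Z_frechet Tc Tb large_bound V0.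
  (* No stationary subset of [I] maps a common neighbourhood into [V], so the part of [I] where
     [kappa] is at most [m] is null. *)
  have Inull m : F (~` [set i | I i /\ (kappa i <= m)%N]).
    have [U U0 UV] := kU m; apply: contrapT.
    apply: (nV U [set i | I i /\ (kappa i <= m)%N] U0) => [i []//|i [_]].
    exact: UV.
  have unb m : filter_stationary F [set i | I i /\ (m < kappa i)%N].
    move=> Fm; apply: Istat; apply: filterS (filterI Fm (Inull m)) => i /= [h1 h2] Ii.
    by case: (leqP (kappa i) m) => im; [apply: h2|apply: h1].
  have [J [g [JI Junb gc gb gU]]] :=
    unbounded_functionals K_real_or_complex X_quotient F_filter F_free small unb.
  have Jstat : filter_stationary F J.
    by apply: filter_stationaryS (Junb 0%N) => i [].
  have [U [J' [U0 J'stat J'J J'U]]] := XP _ g gc gb J _ Jstat ball1.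
  (* On [J'] the common neighbourhood [U] bounds [kappa], so [J'] is null by [Inull]. *)
  have [m mP] := gU U U0; apply: J'stat; apply: filterS (Inull m) => i nI J'i.
  by apply: nI; split; [exact/JI/J'J|apply: mP; [exact: J'J|exact: J'U]].
- exact: ubp.
Qed.
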